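(* If $G_0\in\mathcal{F}_2$, then $\mathsf{in}_t(G_0)\ge 4$.
   Context: A bipath is the union of two edge-disjoint paths $P_1,P_2$ that have the same two endpoints, share at least three vertices in total (including the endpoints), and the shared vertices appear in the same order along $P_1$ and $P_2$; its endpoints are the common endpoints of $P_1,P_2$. $\mathcal{F}_2$ is the set of graphs consisting of three bipaths that share their two endpoints but are otherwise pairwise vertex-disjoint. Zero-visibility $k$-search game on a finite simple graph $G$: an invisible intruder occupies a vertex; players alternate starting with the searcher; on each turn the searcher inspects an arbitrary set of $k$ vertices and wins if the intruder is at one of them; otherwise the intruder may move to an adjacent vertex or stay. $\mathsf{in}(G)$ is the least $k$ for which the searcher has a finite sequence of moves guaranteeing capture. A subdivision is obtained by repeatedly replacing an edge by a path of length two through a new vertex. $\mathsf{in}_t(G)$ is the least $k$ such that every subdivision $H$ of $G$ has a further subdivision $H'$ with $\mathsf{in}(H')\le k$. *)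

(* Defs.v *)
#[warnings="-notation-overridden"]
From mathcomp Require Import all_boot zify.
From mathcomp Require Import boolp.

Set Implicit Arguments.
Unset Strict Implicit.
Unset Printing Implicit Defensive.

Record sgraph := SGraph {
  vertex :> finType;
  adj : rel vertex;
  adj_sym : symmetric adj;
  adj_irr : irreflexive adj }.

Definition edges (G : sgraph) : {set {set G}} :=
  [set [set z.1; z.2] | z in [pred z : G * G | adj z.1 z.2]].

(* A path is given by its first vertex [x] and the sequence [p] of the vertices
   that follow; [y] is its last vertex. *)
Definition is_path (G : sgraph) (x y : G) (p : seq G) : bool :=
  [&& path (@adj G) x p, last x p == y & uniq (x :: p)].

Definition path_vertices (G : sgraph) (x : G) (p : seq G) : {set G} :=
  [set z in x :: p].

Definition path_edges (G : sgraph) (x : G) (p : seq G) : {set {set G}} :=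
  [set:: [seq [set z.1; z.2] | z <- zip (x :: p) p]].

(* Since the vertices of a path are distinct, the equality of the two filtered
   sequences says that the shared vertices occur in the same order. *)
Definition bipath (G : sgraph) (x y : G) (V : {set G}) (E : {set {set G}}) :
    Prop :=
  exists p q : seq G,
    [/\ is_path x y p /\ is_path x y q,
        [disjoint path_edges x p & path_edges x q],
        3 <= #|path_vertices x p :&: path_vertices x q|,
        [seq z <- x :: p | z \in x :: q] = [seq z <- x :: q | z \in x :: p] &
        V = path_vertices x p :|: path_vertices x q /\
        E = path_edges x p :|: path_edges x q].

Definition in_F2 (G : sgraph) : Prop :=
  exists (x y : G) (V : 'I_3 -> {set G}) (E : 'I_3 -> {set {set G}}),
    [/\ forall i, bipath x y (V i) (E i),
        forall i j, i != j -> V i :&: V j = [set x; y],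
        \bigcup_i V i = [set: G] &
        \bigcup_i E i = edges G].

(* The searcher learns nothing before winning, so that a strategy is the
   sequence of the inspected sets.  The intruder is at [w i] when the [i]-th set
   is inspected. *)
Definition intruder_walk (G : sgraph) (w : nat -> G) : Prop :=
  forall i, (w i.+1 == w i) || adj (w i) (w i.+1).

Definition captures (G : sgraph) (s : seq {set G}) : Prop :=
  forall w : nat -> G, intruder_walk w ->
    exists2 i, i < size s & w i \in nth set0 s i.

Definition searcher_wins (G : sgraph) (k : nat) : Prop :=
  exists2 s : seq {set G},
    (forall A : {set G}, A \in s -> #|A| = k) & captures s.

Definition least (P : nat -> Prop) (exP : exists n, P n) : nat :=
  @ex_minn (fun n => `[< P n >])
    (let: ex_intro n Pn := exP in ex_intro _ n (asboolT Pn)).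

Lemma leastP (P : nat -> Prop) (exP : exists n, P n) :
  P (least exP) /\ forall n, P n -> least exP <= n.
Proof.
rewrite /least; case: ex_minnP => m /asboolP Pm minm; split=> // n Pn.
by apply/minm/asboolP.
Qed.

Lemma searcher_wins_card (G : sgraph) : searcher_wins G #|G|.
Proof.
exists [:: setT]; first by move=> A; rewrite inE => /eqP ->; rewrite cardsT.
by move=> w _; exists 0; rewrite //= inE.
Qed.

Definition inspection_number (G : sgraph) : nat :=
  least (ex_intro (searcher_wins G) #|G| (searcher_wins_card G)).

(* The new vertex is [None]. *)
Definition subdiv_rel (G : sgraph) (u v : G) : rel (option G) := fun a b =>
  match a, b with
  | Some a, Some b => adj a b && ((a, b) \notin [:: (u, v); (v, u)])
  | Some a, None => a \in [:: u; v]
  | None, Some b => b \in [:: u; v]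
  | None, None => false
  end.

Fact subdiv_sym (G : sgraph) (u v : G) : symmetric (subdiv_rel u v).
Proof.
case=> [a|] [b|] //=; rewrite adj_sym !inE !xpair_eqE.
by rewrite andbC [in RHS]andbC orbC ![(a == _) && _]andbC.
Qed.

Fact subdiv_irr (G : sgraph) (u v : G) : irreflexive (subdiv_rel u v).
Proof. by case=> [a|] //=; rewrite adj_irr. Qed.

Definition edge_subdivision (G : sgraph) (u v : G) : sgraph :=
  SGraph (subdiv_sym u v) (subdiv_irr u v).

(* Up to isomorphism, these are all the subdivisions of [G], including [G]. *)
Inductive subdivision (G : sgraph) : sgraph -> Prop :=
| subdivision_refl : subdivision G G
| subdivision_step (H : sgraph) (u v : H) :
    subdivision G H -> adj u v -> subdivision G (edge_subdivision u v).

Definition topologically_inspectable (G : sgraph) (k : nat) : Prop :=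
  forall H, subdivision G H ->
    exists2 H', subdivision H H' & inspection_number H' <= k.

(* Some [k] is suitable: #|G| + 2 vertices suffice on every subdivision of [G].
   The branch vertices [S] are inspected at each turn; the other vertices are
   laid out on a line by [f], adjacent ones being consecutive, and a window of
   length 2 sweeps the line. *)

Lemma superset_card (T : finType) (A : {set T}) k :
  #|A| <= k <= #|T| -> exists2 B : {set T}, A \subset B & #|B| = k.
Proof.
case/andP=> Ak kT; have [d] := ubnP (k - #|A|).
elim: d A Ak => // d IH A Ak; rewrite ltnS => Ad.
have [eqk|ltk] := eqVneq #|A| k; first by exists A.
have [x xA] : exists x, x \in ~: A.
  by apply/card_gt0P; have := cardsC A; lia.
have cA : #|x |: A| = #|A|.+1 by rewrite cardsU1 -in_setC xA.
case: (IH (x |: A)); [lia|lia|].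
by move=> B sB cB; exists B => //; apply: subset_trans sB; apply: subsetUr.
Qed.

Lemma inspection_number_le (G : sgraph) (s : seq {set G}) k :
  (forall A : {set G}, A \in s -> #|A| <= k) -> captures s ->
  inspection_number G <= k.
Proof.
have [_ minG] := leastP (ex_intro (searcher_wins G) #|G| (searcher_wins_card G)).
move=> cs wins; have [ltGk|leGk] := ltnP #|G| k.
  exact: leq_trans (minG _ (searcher_wins_card G)) (ltnW ltGk).
apply: minG.
pose pad (A : {set G}) := odflt setT [pick B : {set G} | (A \subset B) && (#|B| == k)].
have padP A : A \in s -> A \subset pad A /\ #|pad A| = k.
  move=> As; rewrite /pad; case: pickP => [B /andP[-> /eqP]//|none].
  have [|B AB cB] := @superset_card _ A k; first by rewrite cs.
  by have := none B; rewrite AB cB eqxx.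
exists (map pad s) => [_ /mapP[A As ->]|w walk]; first by have [] := padP _ As.
have [i lti wi] := wins w walk; exists i; rewrite ?size_map //.
rewrite (nth_map set0) //.
by have [/subsetP sub _] := padP _ (mem_nth set0 lti); apply: sub.
Qed.

Definition linear_layout (G : sgraph) (S : {set G}) (f : G -> nat) : Prop :=
  [/\ {in ~: S &, injective f},
      {in ~: S &, forall x y, adj x y -> f y <= (f x).+1} &
      {in ~: S, forall x a b c, adj x a -> adj x b -> adj x c ->
        [|| a == b, a == c | b == c]}].

Lemma linear_layout_le (G : sgraph) (S : {set G}) (f : G -> nat) :
  linear_layout S f -> inspection_number G <= #|S| + 2.
Proof.
case=> f_inj f_adj _.
pose lev i := [set x in ~: S | f x == i].
have cl i : #|lev i| <= 1.
  apply/card_le1_eqP => x y /setIdP[xS /eqP fx] /setIdP[yS /eqP fy].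
  by apply: f_inj => //; rewrite fx fy.
pose A i := S :|: (lev i :|: lev i.+1).
pose n := (\max_(x : G) f x).+1.
apply: (@inspection_number_le _ (mkseq A n)).
  move=> _ /mapP[i _ ->].
  have := leq_card_setU S (lev i :|: lev i.+1).
  have := leq_card_setU (lev i) (lev i.+1).
  rewrite /A => /leqifP h1 /leqifP h2.
  have := cl i; have := cl i.+1.
  by move: h1 h2; do 2 case: ifP => _; move=> *; lia.
move=> w walk; apply: contrapT => free.
have notA i : i < n -> w i \notin A i.
  move=> ltin; apply/negP => wA; case: free; exists i; rewrite ?size_mkseq //.
  by rewrite nth_mkseq.
have far i : i < n -> w i \notin S /\ i.+1 < f (w i).
  elim: i => [|i IH] ltin; have := notA _ ltin.
    by rewrite !inE !negb_or => /andP[wS]; rewrite wS /=; split=> //; lia.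
  have [wiS fi] := IH (ltnW ltin).
  rewrite !inE !negb_or => /andP[wS]; rewrite wS /= => nf; split=> //.
  suff : f (w i) <= (f (w i.+1)).+1 by lia.
  have /orP[/eqP->//|adjw] := walk i.
  by apply: f_adj; rewrite ?inE // adj_sym.
have [|_] := far n.-1; first by rewrite /n.
have := @leq_bigmax _ f (w n.-1); rewrite /n; lia.
Qed.

Lemma linear_layout_step (G : sgraph) (u v : G) (S : {set G}) (f : G -> nat) :
  adj u v -> linear_layout S f ->
  exists2 S' : {set edge_subdivision u v}, #|S'| = #|S| &
    exists f' : edge_subdivision u v -> nat, linear_layout S' f'.
Proof.
move=> uv [f_inj f_adj f_deg].
have neq_uv : u != v by apply/eqP => e; move: uv; rewrite e adj_irr.
(* the new vertex takes the place [c] *)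
have [c c_old c_new] : exists2 c,
    {in ~: S &, forall a b, adj a b -> (a, b) \notin [:: (u, v); (v, u)] ->
       f b = c -> (f a).+1 <> c} &
    {in [:: u; v], forall x, x \notin S -> f x = c \/ (f x).+1 = c}.
  clear -uv neq_uv f_inj f_adj f_deg.
  wlog vS : u v uv neq_uv / (u \in S) || (v \notin S).
    move=> W; have [/W|] := boolP ((u \in S) || (v \notin S)); first exact.
    rewrite negb_or negbK => /andP[uS vS].
    have [|||c c1 c2] := W v u; rewrite 1?adj_sym 1?eq_sym ?vS //.
    exists c => [a b aS bS ab abn|x xin]; last by apply: c2; rewrite inE orbC -inE; move: xin; rewrite !inE orbC.
    by apply: c1 => //; move: abn; rewrite !inE orbC.
  have [vinS|vnS] := boolP (v \in S).
    move: vS; rewrite vinS orbF => uinS.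
    exists (\max_(x : G) f x).+2 => [a b _ _ _ _ fb|x].
      by have := @leq_bigmax _ f b; rewrite fb => /ltnW; rewrite ltnn.
    by rewrite !inE => /orP[] /eqP-> /negP.
  have [uinS|unS] := boolP (u \in S); last first.
    have fuv : f u <= (f v).+1 by apply: f_adj; rewrite ?inE // adj_sym.
    have fvu : f v <= (f u).+1 by apply: f_adj; rewrite ?inE.
    have nfuv : f u != f v.
      by apply: contra_neq neq_uv; apply: f_inj; rewrite ?inE.
    case: (ltnP (f u) (f v)) => [ltuv|levu].
      have fv : (f u).+1 = f v by apply/eqP; rewrite eqn_leq ltuv fvu.
      exists (f v) => [a b aS bS ab abn fb|x]; last first.
        by rewrite !inE => /orP[] /eqP-> _; [right|left].
      rewrite -fv => -[fa]; move: abn.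
      have -> : a = u by apply: f_inj; rewrite // inE.
      have -> : b = v by apply: f_inj; rewrite // inE.
      by rewrite inE eqxx.
    have fu : (f v).+1 = f u.
      by apply/eqP; rewrite eqn_leq fuv andbT ltn_neqAle eq_sym nfuv.
    exists (f u) => [a b aS bS ab abn fb|x]; last first.
      by rewrite !inE => /orP[] /eqP-> _; [left|right].
    rewrite -fu => -[fa]; move: abn.
    have -> : a = v by apply: f_inj; rewrite // inE.
    have -> : b = u by apply: f_inj; rewrite // inE.
    by rewrite !inE eqxx orbT.
  have vS' : v \in ~: S by rewrite inE.
  have [/existsP[z /and3P[zS vz fz]]|/existsPn none] :=
      boolP [exists z, [&& z \notin S, adj v z & f z < f v]].
    exists (f v).+1 => [a b aS bS ab _ fb [fa]|x]; last first.
      rewrite !inE => /orP[] /eqP->; last by right.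
      by rewrite uinS.
    have ea : a = v by apply: f_inj.
    rewrite ea in ab.
    have vu : adj v u by rewrite adj_sym.
    case/or3P: (f_deg v vS' z b u vz ab vu) => /eqP e.
    - by move: fz; rewrite e fb ltnNge leqnSn.
    - by rewrite e uinS in zS.
    - by move: bS; rewrite inE e uinS.
  exists (f v) => [a b aS bS ab _ fb fa|x]; last first.
    rewrite !inE => /orP[] /eqP->; last by left.
    by rewrite uinS.
  have eb : b = v by apply: f_inj.
  rewrite eb in ab.
  by have := none a; rewrite -in_setC aS adj_sym ab /= -fa leqnn.
have memS (x : G) : (Some x \in [set Some y | y in S]) = (x \in S).
  by rewrite mem_imset //; apply: Some_inj.
have memN : None \in [set Some y | y in S] = false.
  by apply/imsetP => -[].
exists [set Some x | x in S]; first by rewrite card_imset //; apply: Some_inj.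
exists (fun a => if a is Some x then f x + (c <= f x) else c).
split.
- move=> [a|] [b|]; rewrite !in_setC ?memS // => aS bS; last 2 first.
  + by lia.
  + by lia.
  by move=> e; congr Some; apply: f_inj; rewrite ?inE //; lia.
- move=> [a|] [b|]; rewrite !in_setC ?memS //= => aS bS.
  + case/andP=> ab nab.
    have := f_adj a b _ _ ab; rewrite !inE => /(_ aS bS).
    by have := c_old a b _ _ ab nab; rewrite !inE => /(_ aS bS); lia.
  + by move=> /c_new /(_ aS); lia.
  + by move=> /c_new /(_ bS); lia.
- case=> [x|]; rewrite in_setC ?memS => xS.
    pose g (a : option G) := if a is Some y then y else if x == u then v else u.
    have g_adj a : subdiv_rel u v (Some x) a -> adj x (g a).
      case: a => [a|] /=; first by case/andP.
      rewrite !inE; case: eqVneq => [->//|_ /= /eqP->].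
      by rewrite adj_sym.
    have g_inj a b : subdiv_rel u v (Some x) a -> subdiv_rel u v (Some x) b ->
        g a = g b -> a = b.
      case: a b => [a|] [b|] //=; first by move=> _ _ ->.
        case/andP=> _ nab; rewrite !inE => xuv e; move: nab; rewrite e !inE !xpair_eqE.
        by case: eqVneq xuv => [->|_ /= /eqP->]; rewrite !eqxx ?orbT.
      move=> xuv /andP[_ nab] e; move: nab xuv; rewrite -e !inE !xpair_eqE.
      by case: eqVneq => [->|_]; rewrite !eqxx ?orbT //= andbT => /negPf->.
    move=> a b d xa xb xd.
    have xS' : x \in ~: S by rewrite inE.
    have := f_deg x xS' _ _ _ (g_adj _ xa) (g_adj _ xb) (g_adj _ xd).
    by case/or3P=> /eqP /g_inj ->; rewrite ?eqxx ?orbT.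
  case=> [a|] [b|] [d|] //=; rewrite !inE.
  by do 3 case/orP=> /eqP->; rewrite ?eqxx ?orbT.
Qed.

Lemma subdivision_layout (G H : sgraph) : subdivision G H ->
  exists2 S : {set H}, #|S| = #|G| & exists f, linear_layout S f.
Proof.
elim=> [|{}H u v _ [S <- [f lay]] uv]; last exact: linear_layout_step lay.
exists setT; first exact: cardsT.
by exists (fun=> 0); split=> x; rewrite !inE.
Qed.

Lemma topologically_inspectable_card (G : sgraph) :
  topologically_inspectable G (#|G| + 2).
Proof.
move=> H /subdivision_layout[S <- [f lay]].
by exists H; [apply: subdivision_refl | apply: linear_layout_le lay].
Qed.

Definition topological_inspection_number (G : sgraph) : nat :=
  least (ex_intro (topologically_inspectable G) (#|G| + 2)
           (@topologically_inspectable_card G)).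

(* Main.v *)
(** Let [K] be the set of cleared vertices and [F] a set of vertices. A turn with
three inspections increases [#|K :&: F|] by at most [3 - #|bd K :&: F|], where
[bd K] is the set of vertices of [K] with a neighbour outside [K]; so progress is
slow when every nontrivial [K] has two boundary vertices in [F]. Subdivide [G0]
until all arcs between consecutive shared vertices of the bipaths are long. Let
[F] be the union of the two smaller bipaths.

If no arc has about half of the vertices of [F], then [#|K :&: F|] takes a long
interval of values in the middle of its range. There no arc is cleared only in
part, since it would contain a boundary vertex and [F] without this arc, still
2-connected, would need two more. Hence [K :&: F] is a union of whole arcs and
shared vertices, and there are too few such unions.

If some arc [e] has about half of the vertices of [F], then a cycle [Z] formed by
the other side of its bipath and by the shorter side of the other bipath has at
most about [#|e|] vertices. From three well separated vertices of [Z] start paths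
disjoint from [Z] and almost as long as [Z], one in [e] and two in the longer side
of the third bipath, and such a cycle cannot be cleared. *)

Require Import Defs.
From mathcomp Require Import all_boot zify.

Set Implicit Arguments.
Unset Strict Implicit.
Unset Printing Implicit Defensive.

Ltac nlia :=
  repeat match goal with
  | H : context [in_mem _ _] |- _ => clear H
  | H : context [@card _ _] |- _ => clear H
  | H : forall _, _ |- _ => clear H
  end; lia.

(** * Cleared sets and their boundaries *)

Section Clearing.
Variable G : sgraph.
Implicit Types (K A B : {set G}) (s : seq {set G}).

(** What stays cleared when the intruder makes one move. *)
Definition inner K : {set G} := [set v in K | [forall u, adj v u ==> (u \in K)]].

(* The cleared vertices that the next move of the intruder contaminates. *)
Definition bd K : {set G} := K :\: inner K.

Lemma bdP K v : reflect (v \in K /\ exists2 u, adj v u & u \notin K) (v \in bd K).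
Proof.
rewrite !inE; case: (boolP (v \in K)) => vK; rewrite ?andbF ?andbT /=; last first.
  by constructor=> -[].
rewrite negb_forall.
apply: (iffP existsP) => [[u]|[_ [u vu uK]]]; last by exists u; rewrite vu.
by rewrite negb_imply => /andP[]; split=> //; exists u.
Qed.

(* The vertices where the intruder cannot be after the first [t] inspections and
   before his next move. *)
Fixpoint cleared s t : {set G} :=
  if t is t'.+1 then inner (cleared s t') :|: nth set0 s t' else set0.

(** Backwards in time, an uncleared vertex is reached from an uncleared vertex, itself or a
    neighbour. The evading walk obtained in this way rests at [v] from time [t] on, which makes it
    infinite. *)
Lemma avoid_walk s t v : v \notin cleared s t.+1 ->
  exists w, [/\ intruder_walk w, forall i, t <= i -> w i = v &
                forall i, i <= t -> w i \notin nth set0 s i].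
Proof.
elim: t v => [|t IH] v.
  rewrite /= in_setU negb_or => /andP[_ vA]; exists (fun=> v); split=> //.
    by move=> i; rewrite eqxx.
  by case.
rewrite [cleared _ _]/= -/(cleared s t.+1) in_setU negb_or => /andP[vI vA].
have [u uv uK] : exists2 u, (u == v) || adj u v & u \notin cleared s t.+1.
  have [vK|vK] := boolP (v \in cleared s t.+1); last by exists v; rewrite ?eqxx.
  have /bdP[_ [u vu uK]] : v \in bd (cleared s t.+1) by rewrite inE vI.
  by exists u; rewrite // adj_sym vu orbT.
have [w [walk wu wA]] := IH u uK.
exists (fun i => if i <= t then w i else v); split.
- move=> i; case: (ltngtP i t) => [lt|gt|->].
  + exact: walk.
  + by rewrite eqxx.
  + by rewrite wu // eq_sym.
- by move=> i lti; rewrite leqNgt lti.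
- move=> i; rewrite leq_eqVlt ltnS => /orP[/eqP->|le]; first by rewrite ltnn.
  by rewrite le; apply: wA.
Qed.

Lemma captures_cleared s : captures s -> cleared s (size s) = setT.
Proof.
move=> cap; apply/setP => v; rewrite [RHS]inE; apply/negPn/negP => vK.
case sz: (size s) vK => [|m] vK.
  by have [|i] := cap (fun=> v); [move=> i; rewrite eqxx | rewrite sz].
have [w [walk _ wA]] := avoid_walk vK.
have [i] := cap w walk; rewrite sz ltnS => /wA h; exact/negP.
Qed.

(* The vertices of [bd (cleared s t)] are recontaminated unless they are
   inspected. *)
Lemma cleared_step s t B : (forall A, A \in s -> #|A| <= 3) ->
  #|cleared s t.+1 :&: B| + #|bd (cleared s t) :&: B| <= #|cleared s t :&: B| + 3.
Proof.
move=> s3; rewrite /=; set K := cleared s t; set A := nth _ _ _.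
have A3 : #|A| <= 3.
  (* Past the end of [s] the default [set0] is inspected, so the bound holds at every time. *)
  by have [lt|ge] := ltnP t (size s); [apply/s3/mem_nth | rewrite /A nth_default ?cards0].
have e1 : #|(inner K :|: A) :&: B| <= #|inner K :&: B| + #|A|.
  rewrite setIUl; apply: leq_trans (leq_card_setU _ _) _.
  by rewrite leq_add2l subset_leq_card // subsetIl.
have e2 : #|inner K :&: B| + #|bd K :&: B| = #|K :&: B|.
  rewrite -(cardsID (inner K) (K :&: B)); congr (_ + _); apply: eq_card => v; rewrite !inE.
    by case: (v \in K); rewrite ?andbF //= andbC.
  by rewrite -andbA.
lia.
Qed.

Lemma exit_bd K (z : nat -> G) a b : a <= b ->
  (forall k, a <= k < b -> adj (z k) (z k.+1)) -> z a \in K -> z b \notin K ->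
  exists k, [/\ a <= k < b, z k \in bd K & z k.+1 \notin K].
Proof.
elim: b => [|b IH]; first by rewrite leqn0 => /eqP-> _ ->.
rewrite leq_eqVlt => /orP[/eqP-> _ ->//|]; rewrite ltnS => ab adj_z za zb.
have [zbK|zbK] := boolP (z b \in K).
  exists b; split=> //; first by rewrite ab /=.
  by apply/bdP; split=> //; exists (z b.+1) => //; apply: adj_z; rewrite ab /=.
case: (IH ab _ za zbK) => [k /andP[ak kb]|k [/andP[ak kb] kK kn]].
  by apply: adj_z; rewrite ak ltnW.
by exists k; split=> //; rewrite ak ltnW.
Qed.

Lemma enter_bd K (z : nat -> G) a b : a <= b ->
  (forall k, a <= k < b -> adj (z k) (z k.+1)) -> z a \notin K -> z b \in K ->
  exists k, [/\ a < k <= b, z k \in bd K & z k.-1 \notin K].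
Proof.
elim: b => [|b IH]; first by rewrite leqn0 => /eqP-> _ /negPf->.
rewrite leq_eqVlt => /orP[/eqP-> _ /negPf->//|]; rewrite ltnS => ab adj_z za zb.
have [zbK|zbK] := boolP (z b \in K); last first.
  exists b.+1; split=> //; first by rewrite ltnS ab /=.
  by apply/bdP; split=> //; exists (z b) => //; rewrite adj_sym; apply: adj_z; rewrite ab /=.
case: (IH ab _ za zbK) => [k /andP[ak kb]|k [/andP[ak kb] kK kn]].
  by apply: adj_z; rewrite ak ltnW.
by exists k; split=> //; rewrite ak ltnW.
Qed.

(** Between a cleared vertex of [r] and an uncleared one of [x :: r] the status changes. Whichever
    of the two comes first, the cleared vertex at the change lies in [r], not at the start [x]. *)
Lemma ray_bd K x r : path (@adj G) x r -> (x \notin K) || ~~ all [in K] r ->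
  has [in K] r -> exists2 v, v \in r & v \in bd K.
Proof.
move=> /(pathP x) rP out /hasP[v vr vK].
pose z k := nth x (x :: r) k.
have adj_z k : k < size r -> adj (z k) (z k.+1) by move=> /rP.
have [m lem zm] : exists2 m, m <= size r & z m \notin K.
  case/orP: out => [xK|/allPn[u ur uK]]; first by exists 0.
  by exists (index u r).+1; rewrite ?index_mem // /z /= nth_index.
have lti : index v r < size r by rewrite index_mem.
have zv : z (index v r).+1 \in K by rewrite /z /= nth_index.
have in_r k : 0 < k <= size r -> z k \in r by case: k => // k /andP[_ lk]; apply: mem_nth.
have [le|lt] := leqP m (index v r).+1.
  case: (enter_bd le _ zm zv) => [k /andP[_ lk]|k [/andP[mk kv] kb _]]; first by apply: adj_z; lia.
  by exists (z k) => //; apply: in_r; lia.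
case: (exit_bd (ltnW lt) _ zv zm) => [k /andP[_ lk]|k [/andP[mk kv] kb _]]; first by apply: adj_z; lia.
by exists (z k) => //; apply: in_r; lia.
Qed.

End Clearing.

(** * Boundary vertices on a cycle *)

Section Cycle.
Variables (G : sgraph) (K : {set G}) (Z : seq G).
Hypotheses (Zu : uniq Z) (Zc : cycle (@adj G) Z) (Z0 : 0 < size Z).
Let N := size Z.

Variable x0 : G.
(** The cycle is unrolled into a periodic sequence: its arcs become intervals of indices, and any
    [N] consecutive indices run around it once. *)
Let z k := nth x0 Z (k %% N).

Lemma cyc_adj k : adj (z k) (z k.+1).
Proof.
rewrite /z -[k.+1]addn1 -modnDml addn1 /N.
have : k %% size Z < size Z by rewrite ltn_mod.
move: (k %% size Z) => i {k}; case: Z Zc => // x p /(pathP x0) Zp lti.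
have := Zp i; rewrite size_rcons => /(_ lti).
rewrite -rcons_cons !nth_rcons /= lti; move: lti; rewrite /= ltnS leq_eqVlt => /orP[/eqP->|lti].
  by rewrite ltnn eqxx modnn.
by rewrite lti modn_small //= ltnS.
Qed.

Lemma cyc_in k : z k \in Z.
Proof. by rewrite mem_nth // ltn_mod. Qed.

Lemma cyc_inj a k l : a <= k < a + N -> a <= l < a + N -> z k = z l -> k = l.
Proof.
move=> ak al /eqP; rewrite /z nth_uniq ?ltn_mod //.
wlog le : k l ak al / k <= l.
  by move=> W; case/orP: (leq_total k l) => le e; [apply: W|apply/esym/W; rewrite 1?eq_sym].
rewrite eq_sym eqn_mod_dvd // => /dvdn_leq h; have : l - k < N by lia.
by move=> lt; apply/eqP; rewrite eqn_leq le /=; case: (posnP (l - k)) => [|/h]; lia.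
Qed.

Lemma cyc_neq a k l : [&& a <= k, k < l & l < a + N] -> z k != z l.
Proof.
move=> /and3P[ak kl lN]; apply/eqP => e.
have := @cyc_inj a k l _ _ e; clear -ak kl lN; lia.
Qed.

Lemma cyc_pos a v : v \in Z -> a < N -> exists2 k, a < k <= a + N & z k = v.
Proof.
move=> vZ aN; have lt : index v Z < N by rewrite index_mem.
exists (if a < index v Z then index v Z else index v Z + N).
  by case: ifP; lia.
by rewrite /z; case: ifP => _; rewrite ?modnDr modn_small // nth_index.
Qed.

Lemma cyc_start v : v \in Z -> exists2 a, a < N & z a = v.
Proof. by move=> vZ; exists (index v Z); rewrite ?index_mem // /z modn_small ?index_mem // nth_index. Qed.

Lemma cycD k : z (k + N) = z k. Proof. by rewrite /z modnDr. Qed.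

Let bZ := bd K :&: [set v in Z].
Let mem_bZ k : (z k \in bZ) = (z k \in bd K). Proof. by rewrite !inE cyc_in andbT. Qed.

(** On a tour from an uncleared vertex, [K] is entered no later than at the first of two cleared
    vertices and left no earlier than at the second. *)
Lemma cyc_bd2 : 1 < #|K :&: [set v in Z]| < N -> 1 < #|bZ|.
Proof.
case/andP=> /card_gt1P[v1 [v2 [/setIP[v1K]]]]; rewrite inE => v1Z /setIP[v2K]; rewrite inE => v2Z v12 ltN.
have [u uZ uK] : exists2 u, u \in Z & u \notin K.
  apply/allPn/negP => /allP ZK; move: ltN; rewrite (setIidPr _) ?cardsE ?(card_uniqP Zu) ?ltnn //.
  by apply/subsetP => v; rewrite inE => /ZK.
have [a aN za] := cyc_start uZ; rewrite -za in uK.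
have [k1 /andP[ak1 k1N] zk1] := cyc_pos v1Z aN; have [k2 /andP[ak2 k2N] zk2] := cyc_pos v2Z aN.
wlog lt12 : v1 v2 v1K v2K v1Z v2Z v12 k1 k2 ak1 k1N zk1 ak2 k2N zk2 / k1 < k2.
  move=> W; case: (ltngtP k1 k2) => [lt|gt|e].
  - by apply: (W v1 v2 v1K v2K v1Z v2Z v12 k1 k2).
  - by rewrite eq_sym in v12; apply: (W v2 v1 v2K v1K v2Z v1Z v12 k2 k1).
  - by move: v12; rewrite -zk1 e zk2 eqxx.
have uK' : z (a + N) \notin K by rewrite cycD.
rewrite -zk1 in v1K; rewrite -zk2 in v2K.
have [k [/andP[ak kk1] kb _]] := enter_bd (ltnW ak1) (fun k _ => cyc_adj k) uK v1K.
have [l [/andP[k2l lN] lb _]] := exit_bd k2N (fun k _ => cyc_adj k) v2K uK'.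
apply/card_gt1P; exists (z k), (z l); rewrite !mem_bZ; split=> //.
apply: (@cyc_neq a); clear -ak kk1 k2l lN lt12; lia.
Qed.

(** Both arcs of the cycle between [u] and [v] have length at least [c]; the two disjuncts are the
    two possible orders in the list [Z]. *)
Definition separated c u v :=
  [&& u \in Z, v \in Z, index u Z + c <= index v Z & index v Z + c <= index u Z + N] ||
  [&& u \in Z, v \in Z, index v Z + c <= index u Z & index u Z + c <= index v Z + N].

Lemma separatedC c u v : separated c u v = separated c v u.
Proof. by rewrite /separated orbC; congr orb; apply: andbCA. Qed.

Lemma separated_in c u v : separated c u v -> u \in Z /\ v \in Z.
Proof. by case/orP=> /and4P[]. Qed.

Lemma separated_2c c u v : separated c u v -> c + c <= N.
Proof. by case/orP=> /and4P[_ _]; clear; lia. Qed.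

Lemma separated_pos c k l : separated c (z k) (z l) -> k <= l <= k + N -> k + c <= l <= k + N - c.
Proof.
have idx i : index (z i) Z = i %% N by rewrite index_uniq // ltn_mod.
rewrite /separated !idx => h /andP[kl lk].
have := divn_eq k N; have := divn_eq l N; have : k %% N < N by rewrite ltn_mod.
have : l %% N < N by rewrite ltn_mod.
move: (k %% N) (l %% N) (k %/ N) (l %/ N) h => r r' q q' h r'N rN el ek; subst k l.
have N0 : 0 < N by [].
(* As [k <= l <= k + N], the quotients of [k] and [l] by [N] are equal or consecutive. *)
have [qq|qq] := leqP q' q.
  have : q' * N <= q * N by rewrite leq_mul2r qq orbT.
  have [/eqP e|ne] := boolP (q' == q); last first.
    have : q'.+1 * N <= q * N by rewrite leq_mul2r; apply/orP; right; lia.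
    by rewrite mulSn; lia.
  by subst q'; case/orP: h => /and4P[_ _ h1 h2]; lia.
have e1 : q.+1 * N <= q' * N by rewrite leq_mul2r qq orbT.
have [lt2|] := ltnP q.+1 q'.
  have : q.+2 * N <= q' * N by rewrite leq_mul2r lt2 orbT.
  rewrite !mulSn in e1 *; case/orP: h => /and4P[_ _ h1 h2]; lia.
move=> le; have e : q' = q.+1 by lia.
by subst q'; rewrite !mulSn in e1 *; case/orP: h => /and4P[_ _ h1 h2]; lia.
Qed.

(** Both neighbours on the cycle of the only uncleared vertex [w] are boundary vertices, and there
    is room for no other. So [u] and [v] are both among [w] and these neighbours, at cyclic distance
    at most 2. *)
Lemma cyc_almost_full c u v : 3 <= c -> separated c u v -> #|K :&: [set v in Z]|.+1 = N ->
  #|bZ| <= 2 -> (u \notin K) || (u \in bd K) -> (v \notin K) || (v \in bd K) -> False.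
Proof.
move=> c3 sep cK b2 uK vK; have [uZ vZ] := separated_in sep.
have cZ : #|[set v in Z]| = N by rewrite cardsE; apply/card_uniqP.
have cD : #|[set v in Z] :\: K| = 1.
  by apply/eqP; rewrite -(eqn_add2l #|K :&: [set v in Z]|) addn1 cK -cZ setIC cardsID.
have /cards1P[w Dw] : #|[set v in Z] :\: K| == 1 by rewrite cD.
have outK t : t \in Z -> (t \notin K) = (t == w) by move=> tZ; rewrite -in_set1 -Dw !inE tZ andbT.
have wZ : w \in Z by have := set11 w; rewrite -Dw !inE => /andP[].
have [a aN za] := cyc_start wZ.
have wK : w \notin K by rewrite outK.
have N6 : 6 <= N by apply: leq_trans (separated_2c sep); clear -c3; lia.
have near k : k = a.+1 \/ k = a + N.-1 -> z k \in bd K.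
  move=> ek; apply/bdP; split.
    apply/negPn; rewrite outK ?cyc_in // -za eq_sym; apply: (@cyc_neq a).
    clear -ek N6; lia.
  exists w => //; rewrite -za; case: ek => ->; first by rewrite adj_sym cyc_adj.
  by rewrite -(cycD a) -[in z (a + N)](prednK (Z0 : 0 < N)) addnS cyc_adj.
have inbZ t : t \in Z -> (t \notin K) || (t \in bd K) -> exists2 k, k \in [:: a; a.+1; a + N.-1] & z k = t.
  move=> tZ; rewrite outK // => /orP[/eqP->|tb]; first by exists a; rewrite ?inE ?eqxx.
  have [/eqP e|n1] := boolP (z a.+1 == t); first by exists a.+1; rewrite ?inE ?eqxx ?orbT.
  have [/eqP e|n2] := boolP (z (a + N.-1) == t); first by exists (a + N.-1); rewrite ?inE ?eqxx ?orbT.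
  suff : 2 < #|bZ| by rewrite ltnNge b2.
  apply/card_gt2P; exists (z a.+1), (z (a + N.-1)), t; split; split=> //.
  - by rewrite mem_bZ near //; left.
  - by rewrite mem_bZ near //; right.
  - by apply/setIP; rewrite inE.
  - apply: (@cyc_neq a); clear -N6; lia.
  - by rewrite eq_sym.
have [k kin zk] := inbZ u uZ uK; have [l lin zl] := inbZ v vZ vK.
rewrite -zk -zl in sep; rewrite !inE in kin lin.
clear -sep kin lin c3 N6 Zu Z0 Zc.
case/orP: (leq_total k l) => le.
  by have := separated_pos sep; nlia.
by rewrite separatedC in sep; have := separated_pos sep; nlia.
Qed.

(** On a tour, [K] is left after [u], entered before [v], left after [v] and entered before [u]. Two
    boundary vertices can do this only if they are [u] and [v] themselves, and then a third cleared
    vertex brings a third boundary vertex. *)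
Lemma cyc_two_terminals c u v : separated c u v -> u \in K -> v \in K ->
  3 <= #|K :&: [set v in Z]| <= c -> 2 < #|bZ|.
Proof.
move=> sep uK vK /andP[K3 Kc]; have [uZ vZ] := separated_in sep.
rewrite ltnNge; apply/negP => b2.
have [a aN za] := cyc_start uZ; have [b /andP[ab bN] zb] := cyc_pos vZ aN.
have := separated_pos (_ : separated c (z a) (z b)); rewrite za zb => /(_ sep).
rewrite (ltnW ab) bN => /(_ isT) /andP[acb bc].
have N0 : 0 < N by [].
have cN : c < N by apply: leq_trans (separated_2c sep); move: (leq_trans K3 Kc); clear; lia.
have miss k : z k \in K -> exists2 l, k < l <= k + c & z l \notin K.
  (* Since [c < N], the [c + 1] vertices from [z k] on are distinct, too many to be all cleared. *)
  move=> zk; have [/forallP inK|/forallPn[i nK]] := boolP [forall i : 'I_c.+1, z (k + i) \in K].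
    suff : c < #|K :&: [set v in Z]| by rewrite ltnNge Kc.
    have <- : #|[set z (k + i) | i : 'I_c.+1]| = c.+1.
      rewrite card_imset ?card_ord // => i j /(@cyc_inj k) e; apply/val_inj.
      by apply/(@addnI k)/e; have := ltn_ord i; have := ltn_ord j; nlia.
    apply/subset_leq_card/subsetP => _ /imsetP[i _ ->].
    by rewrite !inE inK cyc_in.
  exists (k + i) => //; have := ltn_ord i; case: (posnP i) => [i0|]; last by nlia.
  by rewrite i0 addn0 zk in nK.
have no3 k l m : a <= k < a + N -> a <= l < a + N -> a <= m < a + N ->
    k < l -> l < m -> z k \in bd K -> z l \in bd K -> z m \in bd K -> False.
  move=> ak al am kl lm kb lb mb; suff : 2 < #|bZ| by rewrite ltnNge b2.
  apply/card_gt2P; exists (z k), (z l), (z m); split; split; rewrite ?mem_bZ //.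
  - apply: (@cyc_neq a); clear -ak al kl; lia.
  - apply: (@cyc_neq a); clear -al am lm; lia.
  - rewrite eq_sym; apply: (@cyc_neq a); clear -ak am kl lm; lia.
have zaK : z a \in K by rewrite za.
have zbK : z b \in K by rewrite zb.
have [l1 /andP[al1 l1c] l1K] := miss a zaK; have [l2 /andP[bl2 l2c] l2K] := miss b zbK.
have l1b : l1 <= b by nlia.
have [k1 [/andP[ak1 k1l] k1b k1n]] := exit_bd (ltnW al1) (fun k _ => cyc_adj k) zaK l1K.
have [k2 [/andP[lk2 k2b'] k2b _]] := enter_bd l1b (fun k _ => cyc_adj k) l1K zbK.
have [k3 [/andP[bk3 k3l] k3b k3n]] := exit_bd (ltnW bl2) (fun k _ => cyc_adj k) zbK l2K.
have l2a : l2 <= a + N by nlia.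
have [|k4 [/andP[lk4 k4a] k4b _]] := enter_bd l2a (fun k _ => cyc_adj k) l2K; first by rewrite cycD.
(* The positions satisfy [k1 < k2 <= b <= k3] and [k3 < k4 <= a + N]. Three of them would be
   distinct boundary vertices unless [k3 = b], [k4 = a + N] and [k1 = a]. *)
have e3 : k3 = b.
  apply/eqP; rewrite eqn_leq bk3 andbT leqNgt; apply/negP => lt.
  by apply: (@no3 k1 k2 k3) => //; nlia.
have e4 : k4 = a + N.
  apply/eqP; rewrite eqn_leq k4a leqNgt; apply/negP => lt.
  by apply: (@no3 k1 k2 k4) => //; nlia.
have ab' : z a \in bd K by rewrite -cycD -e4.
have e1 : k1 = a.
  apply/eqP; rewrite eqn_leq ak1 andbT leqNgt; apply/negP => lt.
  by apply: (@no3 a k1 k3) => //; nlia.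
subst k1 k3.
(* The vertices right after [u] and right after [v] are uncleared, so [K] has to be entered again on
   the way to [w]. *)
have [w wKZ /norP[wu wv]] : exists2 w, w \in K :&: [set v in Z] & ~~ ((w == u) || (w == v)).
  have /card_gt2P[w1 [w2 [w3 [[i1 i2 i3] [/eqP n12 /eqP n23 /eqP n31]]]]] := K3.
  have [h1|] := boolP ((w1 == u) || (w1 == v)); last by exists w1.
  have [h2|] := boolP ((w2 == u) || (w2 == v)); last by exists w2.
  exists w3 => //; apply/negP => h3.
  by case/orP: h1 => /eqP e1; case/orP: h2 => /eqP e2; case/orP: h3 => /eqP e3; subst; congruence.
have /setIP[wK] := wKZ; rewrite inE => wZ.
have [m /andP[am mN] zm] := cyc_pos wZ aN.
have mb : m != b by apply/eqP => e; rewrite -zm e zb eqxx in wv.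
have ma : m != a + N by apply/eqP => e; rewrite -zm e cycD za eqxx in wu.
rewrite -zm in wK; case: (ltnP m b) => lt.
  have [k [/andP[k0 k0m] kb _]] := enter_bd am (fun k _ => cyc_adj k) k1n wK.
  by apply: (@no3 a k b) => //; nlia.
have bm : b < m by rewrite ltn_neqAle eq_sym mb.
have [k [/andP[k0 k0m] kb _]] := enter_bd bm (fun k _ => cyc_adj k) k3n wK.
by apply: (@no3 a b k) => //; nlia.
Qed.

End Cycle.

(** * Cycles with three rays *)

(* The invariant: for all but at most one of the rays, the cleared part of the
   cycle and of the ray has less than [size Z] vertices.  A step that violates it
   needs a boundary of exactly two vertices, both on the cycle, so that the ray
   is entirely cleared or entirely contaminated. *)
Lemma cycle_rays_uncapturable (G : sgraph) (Z : seq G) c (tm : 'I_3 -> G) (ray : 'I_3 -> seq G) (s : seq {set G}) :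
  uniq Z -> cycle (@adj G) Z -> 10 <= c ->
  (forall a b, a != b -> separated Z c (tm a) (tm b)) ->
  (forall a, path (@adj G) (tm a) (ray a)) -> (forall a, uniq (ray a)) ->
  (forall a, size (ray a) + c = size Z) ->
  (forall a v, v \in ray a -> v \notin Z) ->
  (forall A : {set G}, A \in s -> #|A| <= 3) -> ~ captures s.
Proof.
move=> Zu Zc c10 sep rayP rayu rayN rayZ s3 cap.
set N := size Z in rayN.
have other (r : 'I_3) : exists a, a != r.
  case: (eqVneq r ord0) => [->|r0]; first by exists ord_max.
  by exists ord0; rewrite eq_sym.
have N2 : c + c <= N by have [a ar] := other ord0; apply: separated_2c (sep _ _ ar).
have Z0 : 0 < size Z by apply: leq_trans N2; clear -c10; lia.
have x0 : G := tm ord0.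
pose Zs := [set v in Z]; pose R a := [set v in ray a].
pose K t := cleared s t; pose f t := #|K t :&: Zs|; pose al a t := #|K t :&: R a|.
have cZ : #|Zs| = N by rewrite cardsE; apply/card_uniqP.
have cR a : #|R a| = N - c.
  by rewrite cardsE (card_uniqP _) ?rayu // -(rayN a) addnK.
have alR a t : al a t <= N - c by rewrite -(cR a) subset_leq_card // subsetIr.
have step a t : f t.+1 + al a t.+1 + (#|bd (K t) :&: Zs| + #|bd (K t) :&: R a|) <= f t + al a t + 3.
  have cardU (X : {set G}) : #|X :&: (Zs :|: R a)| = #|X :&: Zs| + #|X :&: R a|.
    rewrite setIUr cardsU; suff -> : (X :&: Zs) :&: (X :&: R a) = set0 by rewrite cards0 subn0.
    apply/setP => v; rewrite !inE; case: (boolP (v \in ray a)) => [/rayZ/negPf->|]; rewrite ?andbF //.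
  by have := cleared_step t (Zs :|: R a) s3; rewrite !cardU.
have quiet a t : #|bd (K t) :&: R a| = 0 -> al a t = 0 \/ (tm a \in K t) /\ al a t = N - c.
  move=> b0; have [hasK|noK] := boolP (has [in K t] (ray a)); last first.
    left; apply/eqP; rewrite cards_eq0; apply/eqP/setP => v; rewrite !inE.
    by apply/negbTE/negP => /andP[vK vr]; case/hasP: noK; exists v.
  right; case: (boolP ((tm a \notin K t) || ~~ all [in K t] (ray a))) => [out|].
    have [v vr vb] := ray_bd (rayP a) out hasK.
    by move/eqP: b0; rewrite cards_eq0 => /eqP/setP/(_ v); rewrite in_setI vb !inE vr.
  rewrite negb_or !negbK => /andP[-> /allP rK]; split=> //; rewrite -(cR a) /al.
  by congr #|pred_of_set _|; apply/setIidPr/subsetP => v; rewrite inE => /rK.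
have inv t : exists r, forall a, a != r -> f t + al a t < N.
  elim: t => [|t [r IH]].
    exists ord0 => a _; rewrite /f /al /K /= !set0I cards0; apply: leq_trans N2.
    by clear -c10; lia.
  (* A total of at most [5 + (N - c)] grows by at most 3 and stays below [N], since [8 < c]. *)
  have [f5|f6] := leqP (f t) 5.
    exists r => a _; have := step a t; have := alR a t; move: f5 N2 c10; clear; lia.
  have fN : f t < N by have [a ar] := other r; apply: leq_ltn_trans (IH a ar); apply: leq_addr.
  have b2 : 1 < #|bd (K t) :&: Zs|.
    by apply: (cyc_bd2 Zu Zc Z0 x0); rewrite fN andbT; apply: leq_trans f6.
  have grow a : N <= f t.+1 + al a t.+1 -> f t + al a t < N ->
      [/\ #|bd (K t) :&: Zs| = 2, #|bd (K t) :&: R a| = 0 & (f t + al a t).+1 = N].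
    by have := step a t; move: b2; clear; split; lia.
  have [/forallP ok|/forallPn[a]] := boolP [forall a, (a != r) ==> (f t.+1 + al a t.+1 < N)].
    by exists r => a ar; apply: (implyP (ok a)).
  rewrite negb_imply -leqNgt => /andP[ar /grow /(_ (IH a ar)) [bz br fa]].
  case: (quiet a t br) => [al0|[aK aN]].
    (* The ray of [a] is uncleared, so the cycle misses a single vertex. By the invariant every ray
       other than that of [r] is then uncleared, and its terminal is uncleared or on the boundary.
       Two such terminals, those of [a] and of a third index [b], are too far apart. *)
    have fN1 : (f t).+1 = N by rewrite -fa al0 addn0.
    have nonint b : b != r -> (tm b \notin K t) || (tm b \in bd (K t)).
      move=> brr; have alb : al b t = 0 by have := IH b brr; rewrite -fN1; clear; lia.
      have [bK|//] := boolP (tm b \in K t).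
      have := rayP b; have := rayN b; case E: (ray b) => [|v r'].
        by move: N2 c10; clear; rewrite /=; lia.
      move=> _ /= /andP[bv _]; apply/bdP; split=> //; exists v => //; apply/negP => vK.
      move/eqP: alb; rewrite cards_eq0 => /eqP/setP/(_ v).
      by rewrite !inE vK E mem_head.
    have [b bar] : exists b, (b != r) && (b != a).
      apply/existsP; apply: contraT => /existsPn none; exfalso.
      have := card_ord 3; have : #|'I_3| <= #|[set r; a]|.
        apply/subset_leq_card/subsetP => b _; rewrite !inE; apply/negPn; rewrite negb_or.
        exact: none.
      by rewrite cards2; case: (r != a) => h e; rewrite e in h.
    case/andP: bar => brr ba; exfalso.
    apply: (cyc_almost_full Zu Zc Z0 x0 _ (sep b a ba) fN1).
    - by clear -c10; lia.
    - by rewrite bz.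
    - exact: nonint.
    - exact: nonint.
  have fc : (f t).+1 = c by move: fa N2; rewrite aN; clear; lia.
  (* The ray of [a] is cleared and becomes the exceptional one. Every other ray, that of [r]
     included, has total below [N] at time [t], because [f t = c - 1]. If it violated the bound
     next, it would be cleared too, and the two cleared terminals would force a third boundary
     vertex on the cycle. *)
  exists a => b ba; rewrite ltnNge; apply/negP => /grow []; first by have := alR b t; move: fc N2; clear; lia.
  move=> _ /quiet [alb|[bK _] _]; first by move: alb fc N2; clear; lia.
  suff : 2 < #|bd (K t) :&: Zs| by rewrite bz.
  apply: (cyc_two_terminals Zu Zc Z0 x0 (sep b a ba) bK aK).
  by rewrite -/Zs -/(f t); move: f6 fc; clear; lia.
have [r inv_r] := inv (size s); have [a ar] := other r.
have := inv_r a ar; rewrite /f /K captures_cleared // setTI cZ.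
by clear; lia.
Qed.

(** * Slow progress when all cells are small *)

(* A combinatorial trace of 2-connectedness: no set meets [F] in a nontrivial
   part with at most one boundary vertex. *)
Definition tight (G : sgraph) (F : {set G}) :=
  forall K : {set G}, #|bd K :&: F| <= 1 -> #|K :&: F| <= 1 \/ F \subset K.

(* The number of cleared vertices of [F] increases by at most one per turn as long
   as the boundary has two vertices in [F]; it thus takes all the values of an
   interval longer than [2 ^ #|I|].  At each of these values every cell is entirely
   cleared or entirely contaminated, which allows only [2 ^ #|I|] values. *)
Lemma small_cells_uncapturable (G : sgraph) (I : finType) (arc : pred I) (cell : I -> {set G}) F M (s : seq {set G}) :
  F = \bigcup_i cell i ->
  (forall i, ~~ arc i -> #|cell i| <= 1) ->
  (forall i (K : {set G}), arc i -> K :&: cell i != set0 -> ~~ (cell i \subset K) ->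
     bd K :&: cell i != set0) ->
  tight F -> (forall i, arc i -> tight (F :\: cell i)) ->
  (forall i, arc i -> #|cell i| <= M) -> M.*2 + 2 ^ #|I| + 10 <= #|F| ->
  (forall A : {set G}, A \in s -> #|A| <= 3) -> ~ captures s.
Proof.
move=> defF small conn tF tFi cM bigF s3 cap.
have cF i : cell i \subset F by rewrite defF; apply: bigcup_sup.
pose f t := #|cleared s t :&: F|.
have pass g : g <= 2 ^ #|I| -> exists S : {set I}, #|\bigcup_(i in S) cell i| = M + 5 + g.
  move=> gI.
  have ex : exists t, M + 5 + g < f t.
    exists (size s); rewrite /f captures_cleared // setTI; move: bigF gI; clear; lia.
  case: (ex_minnP ex) => -[|t]; first by rewrite /f /= set0I cards0.
  move=> gf min; have fg : f t <= M + 5 + g.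
    by rewrite leqNgt; apply/negP => /min; rewrite ltnn.
  (* This is the turn at which the count first exceeds [M + 5 + g]. Tightness gives at least two
     boundary vertices in [F], hence a gain of at most one: the count before it is exactly
     [M + 5 + g], and the boundary has exactly two vertices in [F]. *)
  have := cleared_step t F s3; rewrite -/(f _) -/(f t) => st.
  set K := cleared s t in st.
  have b1 : 1 < #|bd K :&: F|.
    rewrite ltnNge; apply/negP => /tF[K1|FK]; first by move: K1 gf st; rewrite -/(f t); clear; lia.
    by move: fg bigF gI; rewrite /f (setIidPr FK); clear; lia.
  have b2 : #|bd K :&: F| <= 2 by move: fg gf st; clear; lia.
  have fgE : #|K :&: F| = M + 5 + g by rewrite -/(f t); move: fg gf st b1; clear; lia.
  (* A partly cleared cell contains one of the two boundary vertices, leaving at most one for the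
     rest of [F]. By tightness the rest is almost uncleared or fully cleared, and the count would be
     too small or too large. *)
  have inout i : (cell i \subset K) || (K :&: cell i == set0).
    have [//|nK] /= := boolP (cell i \subset K); apply: contraT => nonempty.
    have [ai|nai] := boolP (arc i); last first.
      case/set0Pn: nonempty => v /setIP[vK vi]; case/negP: nK; apply/subsetP => u ui.
      by rewrite (card_le1_eqP (small i nai) _ _ vi ui).
    have := conn i K ai nonempty nK; rewrite -card_gt0 => bi.
    have split (X : {set G}) : #|X :&: F| = #|X :&: cell i| + #|X :&: (F :\: cell i)|.
      rewrite -(cardsID (cell i) (X :&: F)) -setIA (setIidPr (cF i)); congr (_ + _).
      by apply: eq_card => v; rewrite !inE; case: (v \in X); rewrite ?andbF.
    have iM : #|K :&: cell i| <= M by apply: leq_trans (cM i ai); rewrite subset_leq_card ?subsetIr.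
    case: (tFi i ai K).
    - by move: b2; rewrite split; move: bi; clear; lia.
    - by move=> K1; move: fgE; rewrite split; move: K1 iM; clear; lia.
    - move=> FK; have := split setT; rewrite !setTI => eF.
      move: (cM i ai) fgE bigF gI eF; rewrite split (setIidPr FK).
      by clear; lia.
  exists [set i | cell i \subset K]; rewrite -fgE; apply: eq_card => v.
  rewrite inE defF; apply/bigcupP/andP => [[i]|[vK /bigcupP[i _ vi]]].
    by rewrite inE => /subsetP iK vi; split; [apply: iK | apply/bigcupP; exists i].
  exists i => //; rewrite inE; case/orP: (inout i) => // /eqP/setP/(_ v).
  by rewrite !inE vK vi.
(* Distinct values come from distinct subsets of [I], but there is one value more than there are
   subsets. *)
have [S SP] := fin_all_exists (fun g : 'I_(2 ^ #|I|).+1 => pass g (ltn_ord g)).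
have injS : injective S.
  move=> g h e; apply/val_inj/eqP; rewrite -(eqn_add2l (M + 5)) /= -!SP e //.
have := leq_card S injS; rewrite card_ord (_ : #|{set I}| = 2 ^ #|I|) ?ltnn //.
by rewrite -[in RHS]cardsT -card_powerset; apply: eq_card => A; rewrite !inE subsetT.
Qed.

(** A cycle of [P] with two cleared vertices is fully cleared, by [cyc_bd2]. Of two cleared vertices
    of [F] one is off the boundary; its successor on a cycle of [P] is also cleared, hence so is
    this cycle, with [x] and [y]. Every other cycle of [P] then has the two cleared vertices [x] and
    [y]. *)
Lemma tight_cycles (G : sgraph) (F : {set G}) (x y : G) (P : seq G -> Prop) :
  x != y ->
  (forall Z, P Z -> [/\ uniq Z, cycle (@adj G) Z, {subset Z <= F}, x \in Z & y \in Z]) ->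
  (forall v, v \in F -> exists2 Z, P Z & v \in Z) ->
  tight F.
Proof.
move=> xy PZ cov K b1.
have [K1|] := leqP #|K :&: F| 1; [by left | right].
have full Z : P Z -> 1 < #|K :&: [set v in Z]| -> {subset Z <= K}.
  move=> /PZ[Zu Zc ZF xZ yZ] K2.
  have [ltN|geN] := ltnP #|K :&: [set v in Z]| (size Z).
    have zsz : 0 < size Z by case: (Z) xZ.
    have := cyc_bd2 Zu Zc zsz x (introT andP (conj K2 ltN)).
    rewrite ltnNge (leq_trans _ b1) //; apply/subset_leq_card/setIS/subsetP => v.
    by rewrite inE => /ZF.
  move=> v vZ; have : K :&: [set u in Z] = [set u in Z].
    by apply/eqP; rewrite eqEcard subsetIr cardsE (card_uniqP Zu).
  by move/setP/(_ v); rewrite !inE vZ => /andP[].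
have [v /setIP[vK vF] vb] : exists2 v, v \in K :&: F & v \notin bd K.
  case/card_gt1P: i => u [v [uKF vKF uv]].
  have [ub|] := boolP (u \in bd K); last by exists u.
  exists v => //; apply/negP => vb; move: b1; rewrite leqNgt => /negP; apply.
  case/setIP: uKF => _ uF; case/setIP: vKF => _ vF.
  by apply/card_gt1P; exists u, v; rewrite !in_setI ub uF vb vF.
have [Z1 PZ1 vZ1] := cov v vF; have [Zu Zc ZF xZ yZ] := PZ _ PZ1.
have in_full Z u : P Z -> x \in K -> y \in K -> u \in Z -> u \in K.
  move=> PZ' xK yK; have [_ _ _ xZ' yZ'] := PZ _ PZ'; apply: (full Z PZ').
  by apply/card_gt1P; exists x, y; rewrite !inE xK yK xZ' yZ'.
have Z0 : 0 < size Z1 by case: (Z1) xZ.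
have Z2 : 1 < size Z1.
  by case: (Z1) xZ yZ => [|u [|w Z]] //; rewrite !inE => /eqP xu /eqP yu; rewrite xu yu eqxx in xy.
have [a aN za] := cyc_start x vZ1.
have nextK : nth x Z1 (a.+1 %% size Z1) \in K.
  apply: contraR vb => nK; apply/bdP; split=> //; exists (nth x Z1 (a.+1 %% size Z1)) => //.
  by rewrite -za; apply: cyc_adj.
have ZK := full Z1 PZ1.
have [xK yK] : x \in K /\ y \in K.
  split; apply: ZK => //; apply/card_gt1P; exists v, (nth x Z1 (a.+1 %% size Z1));
    rewrite !inE vK vZ1 nextK mem_nth ?ltn_mod // -za;
    by split=> //; apply: (@cyc_neq _ _ Zu Zc Z0 x a); move: Z2; clear; lia.
by apply/subsetP => u /cov[Z PZ' uZ]; apply: in_full PZ' xK yK uZ.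
Qed.

(** * Subdivisions of three bipaths *)

(* The shared vertices of the [i]-th bipath are [cut i 0], ..., [cut i (n i)], in
   order, and [int i j b] lists the interior of the part of its path [b] between
   [cut i j] and [cut i j.+1]; the values at larger [j] are junk. *)
Record f2s (H : sgraph) (n : 'I_3 -> nat) (cut : 'I_3 -> nat -> H)
    (int : 'I_3 -> nat -> bool -> seq H) : Prop := F2S {
  f2_n : forall i, 1 < n i;
  f2_x : forall i i', cut i 0 = cut i' 0;
  f2_y : forall i i', cut i (n i) = cut i' (n i');
  f2_path : forall i j b, j < n i -> path (@adj H) (cut i j) (rcons (int i j b) (cut i j.+1));
  f2_uniq : forall i j b, j < n i -> uniq (int i j b);
  f2_int : forall i j b i' j' b' v, j < n i -> j' < n i' ->
    v \in int i j b -> v \in int i' j' b' -> [/\ i = i', j = j' & b = b'];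
  f2_cut : forall i j b i' j', j < n i -> j' <= n i' -> cut i' j' \notin int i j b;
  f2_inj : forall i j i' j', j <= n i -> j' <= n i' -> cut i j = cut i' j' ->
    [\/ i = i' /\ j = j', j = 0 /\ j' = 0 | j = n i /\ j' = n i'];
  f2_thin : forall i j, j < n i -> int i j true ++ int i j false != [::] }.

Section Insert.
Variables (H : sgraph) (u v : H).

Let e (x z : H) := (x, z) \in [:: (u, v); (v, u)].

(** The interior, after the subdivision, of the path from [x] through [a] to [c]: [None] is inserted
    where the path follows the edge [uv], in either direction. *)
Fixpoint insb (x : H) (a : seq H) (c : H) : seq (edge_subdivision u v) :=
  if a is z :: a' then (if e x z then [:: None] else [::]) ++ Some z :: insb z a' c
  else if e x c then [:: None] else [::].

Lemma mem_insb x a c z : (Some z \in insb x a c) = (z \in a).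
Proof.
elim: a x => [|w a IH] x /=; first by case: (e x c).
by rewrite mem_cat !inE IH; case: (e x w).
Qed.

Lemma size_insb x a c : size a <= size (insb x a c).
Proof.
elim: a x => [|w a IH] x //=.
by rewrite size_cat /=; apply: leq_trans (leq_addl _ _); rewrite ltnS.
Qed.

Lemma step_insb x z : adj x z ->
  path (subdiv_rel u v) (Some x) ((if e x z then [:: None] else [::]) ++ [:: Some z]).
Proof.
rewrite /e; case: ifP => [E|E] /= xz; last by rewrite xz E.
by move: E; rewrite !inE !xpair_eqE => /orP[] /andP[/eqP-> /eqP->]; rewrite !eqxx ?orbT.
Qed.

Lemma path_insb x a c : path (@adj H) x (rcons a c) ->
  path (@adj (edge_subdivision u v)) (Some x) (rcons (insb x a c) (Some c)).
Proof.
elim: a x => [|w a IH] x /= => [/andP[xc _]|/andP[xw wP]].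
  by rewrite -cats1; apply: step_insb.
have := step_insb xw; rewrite rcons_cat !cat_path /= => /and3P[-> -> _] /=.
exact: IH.
Qed.

(** An edge of a path with nonempty interior has an end in this interior. Interiors being disjoint,
    this identifies the arc that receives the new vertex. *)
Lemma None_insb x a c : None \in insb x a c ->
  [/\ u \in x :: rcons a c, v \in x :: rcons a c &
      if a is [::] then e x c else (u \in a) || (v \in a)].
Proof.
elim: a x => [|w a IH] x.
  rewrite /=; case: ifP => // E _; split=> //; move: E; rewrite /e !inE !xpair_eqE;
  by case/orP=> /andP[/eqP-> /eqP->]; rewrite eqxx ?orbT.
rewrite [insb _ _ _]/= mem_cat inE /=; case: ifP => [E _|_].
  move: E; rewrite /e !inE !xpair_eqE !mem_rcons !inE.
  by case/orP=> /andP[/eqP-> /eqP->]; rewrite !eqxx ?orbT.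
rewrite in_nil !orFb => /IH[ui vi d]; rewrite !(in_cons x) ui vi !orbT; split=> //.
case: a ui vi d {IH} => [|z a] ui vi d.
  by move: d; rewrite /e !inE !xpair_eqE => /orP[] /andP[/eqP-> _]; rewrite eqxx ?orbT.
by rewrite !(in_cons w); case/orP: d => ->; rewrite !orbT.
Qed.

Lemma uniq_insb x a c : uniq (x :: rcons a c) -> uniq (insb x a c).
Proof.
elim: a x => [|w a IH] x; first by rewrite /=; case: (e x c).
rewrite [rcons _ _]/= cons_uniq => /andP[xn wu].
have ui := IH w wu; have wn : w \notin a.
  by move: wu; rewrite /= mem_rcons inE negb_or => /andP[/andP[]].
rewrite [insb _ _ _]/=; case: ifP => E /=; last by rewrite mem_insb wn.
rewrite inE /= mem_insb wn ui !andbT; apply/negP => /None_insb[ua va _].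
case/negP: xn; move: E; rewrite /e !inE !xpair_eqE; rewrite !inE in ua va.
by case/orP=> /andP[/eqP-> _].
Qed.

Lemma subdiv_insb x a c : (x, head c a) = (u, v) -> size a < size (insb x a c).
Proof.
case: a => [|z a] /= [-> ->]; rewrite /e !inE eqxx //=.
by rewrite !ltnS size_insb.
Qed.

End Insert.

(** The point is that the new vertex enters only one arc. If one of two arcs receiving it has an
    interior vertex, disjointness decides; two arcs that are single edges with the same ends are
    excluded by [f2_thin]. *)
Lemma f2s_subdivision (H : sgraph) n cut int (u v : H) : adj u v ->
  f2s n cut int ->
  @f2s (edge_subdivision u v) n (fun i j => Some (cut i j))
    (fun i j b => insb u v (cut i j) (int i j b) (cut i j.+1)).
Proof.
move=> uv S; have nI := f2_n S; split.
- exact: nI.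
- by move=> i i'; rewrite (f2_x S i i').
- by move=> i i'; rewrite (f2_y S i i').
- by move=> i j b ji; apply/path_insb/(f2_path S).
- move=> i j b ji; apply: uniq_insb.
  rewrite /= rcons_uniq mem_rcons inE negb_or (f2_uniq S) // !(f2_cut S) ?andbT //; last exact: ltnW.
  by apply/eqP => /(f2_inj S (ltnW ji) ji) [][]; have := nI i; move: ji; clear; lia.
- move=> i j b i' j' b' [w|] ji ji'; first by rewrite !mem_insb; apply: (f2_int S).
  move=> /None_insb[ui vi d] /None_insb[ui' vi' d'].
  have key k l c k' l' c' (w : H) : l < n k -> l' < n k' -> w \in int k l c ->
      w \in cut k' l' :: rcons (int k' l' c') (cut k' l'.+1) -> [/\ k = k', l = l' & c = c'].
    move=> lk lk' wi; rewrite inE mem_rcons inE => /or3P[/eqP e|/eqP e|].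
    + by have := f2_cut S c lk (ltnW lk'); rewrite -e wi.
    + by have := f2_cut S c lk lk'; rewrite -e wi.
    + exact: (f2_int S).
  case E: (int i j b) d => [|z a] d; last first.
    by rewrite -E in d; case/orP: d => wi; apply: (key i j b i' j' b' _ ji ji' wi).
  case E': (int i' j' b') d' => [|z a] d'; last first.
    by rewrite -E' in d'; case/orP: d' => wi; case: (key i' j' b' i j b _ ji' ji wi).
  (* Both arcs are the edge [uv]. Their common ends determine [i] and [j], because [1 < n i]
     prevents an arc from joining the two poles. *)
  have [ii jj] : i = i' /\ j = j'.
    have ni := nI i; have ni' := nI i'.
    have [[e1 e2]|[e1 e2]] : (cut i j = cut i' j' /\ cut i j.+1 = cut i' j'.+1) \/
        (cut i j = cut i' j'.+1 /\ cut i j.+1 = cut i' j').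
      by move: d d'; rewrite !inE !xpair_eqE;
        move=> /orP[]/andP[/eqP-> /eqP->] /orP[]/andP[/eqP-> /eqP->]; auto.
    + case: (f2_inj S (ltnW ji) (ltnW ji') e1) => -[a1 a2] //; last by move: a1 ji; clear; lia.
      case: (f2_inj S ji ji' e2) => -[c1 c2] //; last by move: c1 a1 ni; clear; lia.
      by split=> //; rewrite a1 a2.
    + by case: (f2_inj S (ltnW ji) ji' e1) => -[a1 a2]; case: (f2_inj S ji (ltnW ji') e2) => -[c1 c2];
        move: a1 a2 c1 c2 ji ji'; clear; lia.
  split=> //; subst i' j'; case: (b =P b') => // bb.
  by have := f2_thin S ji; move: bb E E'; clear; case: b b' => [] [] // _ -> ->.
- by move=> i j b i' j' ji ji'; rewrite mem_insb (f2_cut S).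
- by move=> i j i' j' ji ji' [] /(f2_inj S); apply.
- move=> i j ji; have := f2_thin S ji; rewrite -!size_eq0 !size_cat -!lt0n => h.
  by apply: leq_trans h (leq_add _ _); apply: size_insb.
Qed.

Definition longer n (H H' : sgraph) (int : 'I_3 -> nat -> bool -> seq H)
    (int' : 'I_3 -> nat -> bool -> seq H') :=
  forall i j b, j < n i -> size (int i j b) <= size (int' i j b).

Definition long n L (H : sgraph) := exists cut (int : 'I_3 -> nat -> bool -> seq H),
  f2s n cut int /\ forall i j b, j < n i -> L <= size (int i j b).

Lemma long_subdivision n L (H H' : sgraph) : subdivision H H' -> long n L H -> long n L H'.
Proof.
elim=> // {}H' u v _ IH uv /IH[cut [int [S Lint]]].
exists (fun i j => Some (cut i j)), (fun i j b => insb u v (cut i j) (int i j b) (cut i j.+1)).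
split; first exact: f2s_subdivision.
by move=> i j b ji; apply: leq_trans (Lint i j b ji) (size_insb _ _ _ _ _).
Qed.

(** Each subdivision of the first edge of the arc adds a vertex to its interior. *)
Lemma lengthen_arc (G H : sgraph) n cut (int : 'I_3 -> nat -> bool -> seq H) k i0 j0 (b0 : bool) :
  subdivision G H -> f2s n cut int -> j0 < n i0 ->
  exists (H' : sgraph) cut' (int' : 'I_3 -> nat -> bool -> seq H'),
    [/\ subdivision G H', f2s n cut' int', longer n int int' & k <= size (int' i0 j0 b0)].
Proof.
move=> GH S ji; elim: k => [|k [H' [cut' [int' [GH' S' le ge]]]]].
  by exists H, cut, int; split=> // i j b.
set u := cut' i0 j0; set v := head (cut' i0 j0.+1) (int' i0 j0 b0).
have uv : adj u v.
  have := f2_path S' b0 ji; rewrite /u /v.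
  by case: (int' i0 j0 b0) => [|z a] /= /andP[].
have := f2s_subdivision uv S'; set int'' := (fun i j b => insb u v _ _ _) => S''.
exists (edge_subdivision u v), (fun i j => Some (cut' i j)), int''; split=> //.
- exact: subdivision_step.
- by move=> i j b lt; apply: leq_trans (le i j b lt) (size_insb _ _ _ _ _).
- by apply: leq_ltn_trans ge _; apply: subdiv_insb.
Qed.

Lemma lengthen (G : sgraph) n L : long n 0 G -> exists2 H, subdivision G H & long n L H.
Proof.
case=> cut [int [S _]].
pose N := \max_i n i.
suff [H [cut' [int' [GH S' le]]]] : exists (H : sgraph) cut' (int' : 'I_3 -> nat -> bool -> seq H),
    [/\ subdivision G H, f2s n cut' int' & forall e : 'I_3 * 'I_N * bool, e \in enum predT ->
        e.1.2 < n e.1.1 -> L <= size (int' e.1.1 e.1.2 e.2)].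
  exists H => //; exists cut', int'; split=> // i j b ji.
  have jN : j < N by apply: leq_trans ji (leq_bigmax i).
  by apply: (le (i, Ordinal jN, b)); rewrite // mem_enum.
elim: (enum _) => [|[[i j] b] l [H [cut' [int' [GH S' le]]]]].
  by exists G, cut, int; split=> //; apply: subdivision_refl.
have [ji|ij] := ltnP j (n i); last first.
  exists H, cut', int'; split=> // e; rewrite inE => /orP[/eqP->|/le//].
  by rewrite /= ltnNge ij.
have [H' [cut'' [int'' [GH' S'' le' ge]]]] := lengthen_arc L b GH S' ji.
exists H', cut'', int''; split=> // e; rewrite inE => /orP[/eqP->//|el eij].
exact: leq_trans (le e el eij) (le' _ _ _ eij).
Qed.

(** * Decomposition of a bipath at its shared vertices *)

(** The lists [side true] and [side false] are the two paths without their first vertex [x]. A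
    degenerate pair of parts is recorded in [bc_thin] as a common edge, to be excluded by
    edge-disjointness. *)
Record bicut (G : sgraph) (x y : G) (side : bool -> seq G) n (cut : nat -> G)
    (int : nat -> bool -> seq G) : Prop := Bicut {
  bc_x : cut 0 = x;
  bc_y : cut n = y;
  bc_path : forall j b, j < n -> path (@adj G) (cut j) (rcons (int j b) (cut j.+1));
  bc_uniq : forall j b, j < n -> uniq (int j b);
  bc_own : forall j b v, j < n -> v \in int j b -> v \in side b;
  bc_other : forall j b v, j < n -> v \in int j b -> v \notin x :: side (~~ b);
  bc_int : forall j j' b v, j < n -> j' < n -> v \in int j b -> v \in int j' b -> j = j';
  bc_cut : forall j b, j <= n -> cut j \in x :: side b;
  bc_inj : forall j j', j <= n -> j' <= n -> cut j = cut j' -> j = j';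
  bc_shared : forall v, (forall b, v \in x :: side b) -> exists2 j, j <= n & cut j = v;
  bc_thin : forall j, j < n -> int j true ++ int j false = [::] ->
    forall b, [set cut j; cut j.+1] \in path_edges x (side b) }.

Lemma path_edges_cat (G : sgraph) (x c : G) p1 p2 :
  path_edges x (p1 ++ c :: p2) = path_edges x (rcons p1 c) :|: path_edges c p2.
Proof.
rewrite /path_edges -cat_rcons.
have -> : zip (x :: rcons p1 c ++ p2) (rcons p1 c ++ p2) =
    zip (x :: rcons p1 c) (rcons p1 c) ++ zip (c :: p2) p2.
  elim: p1 x => [|z p1 IH] x /=; first by [].
  by congr cons; apply: IH.
by apply/setP => E; rewrite map_cat !inE mem_cat.
Qed.

(** After [x], the two equal filtered sequences start with the first vertex of [p] in [q] and with
    the first vertex of [q] in [p], which therefore coincide. *)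
Lemma first_shared (T : eqType) (x : T) (p q : seq T) : x \notin p -> x \notin q ->
  [seq z <- x :: p | z \in x :: q] = [seq z <- x :: q | z \in x :: p] -> has [in q] p ->
  exists c p1 p2 q1 q2, [/\ p = p1 ++ c :: p2, q = q1 ++ c :: q2,
     forall v, v \in p1 -> v \notin q & forall v, v \in q1 -> v \notin p].
Proof.
move=> xp xq; rewrite /= !inE eqxx /= => -[].
have eqf (s t : seq T) : x \notin s -> [seq z <- s | z \in x :: t] = [seq z <- s | z \in t].
  by move=> xs; apply: eq_in_filter => z zs; rewrite inE; case: eqP => // e; rewrite -e zs in xs.
rewrite !eqf // => fE hp.
have first (s : seq T) (a : pred T) : has a s ->
    exists c s1 s2, [/\ s = s1 ++ c :: s2, a c, {in s1, forall v, ~~ a v} & filter a s = c :: filter a s2].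
  elim: s => //= z s IHs; case: ifP => [az _|az /IHs[c [s1 [s2 [-> ac n1 ->]]]]].
    by exists z, [::], s.
  exists c, (z :: s1), s2; split=> // v; rewrite inE => /orP[/eqP->|/n1//].
  by rewrite az.
have [c [p1 [p2 [ep cq p1n e1]]]] := first p _ hp.
have hq : has [in p] q.
  by case/hasP: hp => z zp zq; apply/hasP; exists z.
have [d [q1 [q2 [eq_ dp q1n e2]]]] := first q _ hq.
exists c, p1, p2, q1, q2; split=> //.
by move: fE; rewrite e1 e2 => -[->].
Qed.

(** By induction on the length: both paths are split at their first shared vertex [c] after [x], and
    the tails from [c] are decomposed in turn, until [x = y]. *)
Lemma bicut_exists (G : sgraph) (x y : G) p q : is_path x y p -> is_path x y q ->
  [disjoint path_edges x p & path_edges x q] ->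
  [seq z <- x :: p | z \in x :: q] = [seq z <- x :: q | z \in x :: p] ->
  exists n cut int, bicut x y (fun b => if b then p else q) n cut int.
Proof.
have [m] := ubnP (size p); elim: m x p q => // m IH x p q szp.
case/and3P=> pP /eqP py pu /and3P[qP /eqP qy qu] dis fE.
have [xp xq] : x \notin p /\ x \notin q by move: pu qu => /andP[? _] /andP[? _].
have [xy|xy] := eqVneq x y.
  have nil (s : seq G) : last x s = y -> x \notin s -> s = [::].
    case: s => // z s; rewrite -xy /= => <-; rewrite mem_last //.
  rewrite (nil p) // (nil q) //; exists 0, (fun=> x), (fun _ _ => [::]); split=> //.
  - by move=> j b _; rewrite inE eqxx.
  - by case=> // -[].
  - by move=> v /(_ true); rewrite inE => /eqP->; exists 0.
have lastin (s : seq G) : last x s = y -> y \in s.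
  by move=> e; have := mem_last x s; rewrite e inE eq_sym (negPf xy).
have hpq : has [in q] p by apply/hasP; exists y; apply: lastin.
have [c [p1 [p2 [q1 [q2 [ep eq_ p1q q1p]]]]]] := first_shared xp xq fE hpq.
subst p q.
move: pu; rewrite cons_uniq cat_uniq => /and4P[_ p1u p1p2 p2u].
move: qu; rewrite cons_uniq cat_uniq => /and4P[_ q1u q1q2 q2u].
move: pP qP; rewrite !cat_path => /andP[p1P /andP[p1c p2P]] /andP[q1P /andP[q1c q2P]].
rewrite !last_cat /= in py qy.
have p1n v : v \in p1 -> v \notin c :: p2 by move=> v1; apply: contra p1p2 => v2; apply/hasP; exists v.
have q1n v : v \in q1 -> v \notin c :: q2 by move=> v1; apply: contra q1q2 => v2; apply/hasP; exists v.
(* Before [c] only [x] is shared, and no vertex from [c] on lies in the initial part of the other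
   path; so the order condition passes to the tails. *)
have fE2 : [seq z <- c :: p2 | z \in c :: q2] = [seq z <- c :: q2 | z \in c :: p2].
  pose aq := [in x :: q1 ++ c :: q2]; pose ap := [in x :: p1 ++ c :: p2].
  have : filter aq (x :: p1) ++ filter aq (c :: p2) = filter ap (x :: q1) ++ filter ap (c :: q2).
    by rewrite -!filter_cat.
  set A1 := filter _ (x :: p1); set B1 := filter _ (c :: p2).
  set A2 := filter _ (x :: q1); set B2 := filter _ (c :: q2).
  have -> : A1 = [:: x].
    rewrite /A1 /aq /= inE eqxx /=; congr cons; apply/eqP; rewrite -(negbK (_ == _)) -has_filter.
    apply/hasPn => v v1; rewrite in_cons negb_or p1q // andbT.
    by apply: contra xp => /eqP<-; rewrite mem_cat v1.
  have -> : A2 = [:: x].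
    rewrite /A2 /ap /= inE eqxx /=; congr cons; apply/eqP; rewrite -(negbK (_ == _)) -has_filter.
    apply/hasPn => v v1; rewrite in_cons negb_or q1p // andbT.
    by apply: contra xq => /eqP<-; rewrite mem_cat v1.
  move=> [] BE; transitivity B1; last rewrite BE.
    apply: eq_in_filter => v v2; rewrite /aq /= (in_cons x) mem_cat.
    case: eqP => [e|_] /=; first by case/negP: xp; rewrite -e mem_cat v2 orbT.
    by case: (boolP (v \in q1)) => // /q1p; rewrite mem_cat v2 orbT.
  apply: eq_in_filter => v v2; rewrite /ap /= (in_cons x) mem_cat.
  case: eqP => [e|_] /=; first by case/negP: xq; rewrite -e mem_cat v2 orbT.
  by case: (boolP (v \in p1)) => // /p1q; rewrite mem_cat v2 orbT.
have [|||||n [cut [int S]]] := IH c p2 q2.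
- by move: szp; rewrite size_cat /=; clear; lia.
- by apply/and3P; split=> //; apply/eqP.
- by apply/and3P; split=> //; apply/eqP.
- by apply: disjointWl (disjointWr _ dis); rewrite path_edges_cat subsetUr.
- by [].
pose side (b : bool) := if b then p1 ++ c :: p2 else q1 ++ c :: q2.
pose side1 (b : bool) := if b then p1 else q1.
pose side2 (b : bool) := if b then p2 else q2.
have sideE b : side b = side1 b ++ c :: side2 b by case: b.
have xs b : x \notin side b by case: b.
have xs2 b : x \notin c :: side2 b.
  by apply: contra (xs b); rewrite sideE mem_cat orbC => ->.
have s1n b v : v \in side1 b -> v \notin side (~~ b) by case: b => /= [/p1q|/q1p].
have s1n2 b v : v \in side1 b -> v \notin c :: side2 b by case: b => /= [/p1n|/q1n].
have s2s b v : v \in c :: side2 b -> v \in side b by rewrite sideE mem_cat orbC => ->.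
have s1s b v : v \in side1 b -> v \in side b by rewrite sideE mem_cat => ->.
have ints2 j b v : j < n -> v \in int j b -> v \in c :: side2 b.
  by move=> ji vi; rewrite inE (bc_own S ji vi) orbT.
have cutc j b : j <= n -> cut j \in c :: side2 b by move=> jn; apply: (bc_cut S).
exists n.+1, (fun j => if j is j'.+1 then cut j' else x),
  (fun j b => if j is j'.+1 then int j' b else side1 b).
rewrite -/side; split=> //=.
- exact: (bc_y S).
- case=> [|j] b; last exact: (bc_path S).
  by rewrite (bc_x S) rcons_path; case: b => /= _; apply/andP.
- by case=> [|j] b; [case: b | apply: (bc_uniq S)].
- by move=> [|j] b v lt vi; [apply: s1s | apply/s2s/(ints2 j)].
- move=> [|j] b v lt vi; rewrite inE negb_or.
    by rewrite s1n // andbT; apply: contraNneq (xs b) => <-; apply: s1s.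
  have v2 := ints2 j b v lt vi; apply/andP; split; first by apply: contraNneq (xs2 b) => <-.
  rewrite sideE mem_cat (negPf (bc_other S lt vi)) orbF; apply/negP => /s1n.
  by rewrite negbK s2s.
- move=> [|j] [|j'] b v lt lt' // vi vi'.
  + by have := s1n2 _ _ vi; rewrite (ints2 j').
  + by have := s1n2 _ _ vi'; rewrite (ints2 j).
  + by congr _.+1; apply: (bc_int S lt lt' vi vi').
- by move=> [|j] b lt; rewrite inE ?eqxx // s2s ?orbT // cutc.
- move=> [|j] [|j'] lt lt' // e.
  + by have := xs2 true; rewrite e cutc.
  + by have := xs2 true; rewrite -e cutc.
  + by congr _.+1; apply: (bc_inj S lt lt' e).
- move=> v vs; have [->|vx] := eqVneq v x; first by exists 0.
  have vs' b : v \in side b by have := vs b; rewrite inE (negPf vx).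
  have [|j jn <-] := bc_shared S (v := v); last by exists j.+1.
  move=> b; have := vs' b; rewrite sideE mem_cat => /orP[/s1n|//].
  by rewrite vs'.
- move=> [|j] lt e b.
    have [e1 e2] : p1 = [::] /\ q1 = [::] by move: e; rewrite /side1; case: (p1) => //; case: (q1).
    by rewrite (bc_x S) sideE; case: b; rewrite /side1 ?e1 ?e2 /path_edges /= !inE eqxx.
  have := bc_thin S lt e b; rewrite sideE path_edges_cat in_setU => ->.
  by rewrite orbT.
Qed.

(** Different bipaths meet only in [x] and [y], which are cut vertices, so all interiors are
    disjoint. *)
Lemma in_F2_long (G : sgraph) : in_F2 G -> exists n, long n 0 G.
Proof.
case=> x [y [V [E [bip VI _ _]]]].
have ex i : exists pq : seq G * seq G, exists n cut int,
    [/\ bicut x y (fun b => if b then pq.1 else pq.2) n cut int, 1 < n,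
        [disjoint path_edges x pq.1 & path_edges x pq.2] &
        V i = path_vertices x pq.1 :|: path_vertices x pq.2].
  have [p [q [[xp xq] dis c3 fE [VE _]]]] := bip i.
  have [n [cut [int S]]] := bicut_exists xp xq dis fE.
  exists (p, q), n, cut, int; split=> //.
  (* The shared vertices are among [cut 0], ..., [cut n], so three of them force [1 < n]. *)
  have : #|path_vertices x p :&: path_vertices x q| <= #|[set cut (val j) | j : 'I_n.+1]|.
    apply/subset_leq_card/subsetP => v /setIP[vp vq].
    have [|j jn <-] := bc_shared S (v := v); first by move: vp vq; rewrite !inE => ? ? [].
    by apply/imsetP; exists (Ordinal (jn : j < n.+1)).
  by move=> h; have := leq_trans c3 (leq_trans h (leq_imset_card _ _)); rewrite card_ord.
have {ex} [pq ex] := fin_all_exists ex; have {ex} [n ex] := fin_all_exists ex.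
have {ex} [cut ex] := fin_all_exists ex; have {ex} [int ex] := fin_all_exists ex.
have S i := let: And4 h _ _ _ := ex i in h.
have n1 i : 1 < n i by case: (ex i).
have Vs i b v : v \in x :: (if b then (pq i).1 else (pq i).2) -> v \in V i.
  by case: (ex i) => _ _ _ ->; rewrite !inE; case: b => ->; rewrite ?orbT.
have Vi i j b v : j < n i -> v \in int i j b -> v \in V i.
  by move=> ji vi; apply: (Vs i b); rewrite inE (bc_own (S i) ji vi) orbT.
have Vc i j : j <= n i -> cut i j \in V i by move=> ji; apply: (Vs i true); apply: (bc_cut (S i) true ji).
have xy i i' v : i != i' -> v \in V i -> v \in V i' -> v = x \/ v = y.
  by move=> /VI /setP/(_ v); rewrite !inE => e vi vi'; move: e; rewrite vi vi' => /esym/orP[]/eqP; auto.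
have cutni i j b i' j' : j < n i -> j' <= n i' -> cut i' j' \notin int i j b.
  have own i0 j0 j1 b0 : j0 < n i0 -> j1 <= n i0 -> cut i0 j1 \notin int i0 j0 b0.
    by move=> lt le; apply/negP => /(bc_other (S i0) lt); rewrite (bc_cut (S i0) _ le).
  move=> ji ji'; have [e|ii] := eqVneq i' i; first by subst i'; apply: own.
  apply/negP => vi; case: (xy _ _ _ ii (Vc i' j' ji') (Vi _ _ _ _ ji vi)) => e.
  - by have := own i j 0 b ji isT; rewrite (bc_x (S i)) -e vi.
  - by have := own i j (n i) b ji (leqnn _); rewrite (bc_y (S i)) -e vi.
exists n, cut, int; split=> //; split=> //.
- by move=> i i'; rewrite !(bc_x (S _)).
- by move=> i i'; rewrite !(bc_y (S _)).
- by move=> i; apply: (bc_path (S i)).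
- by move=> i; apply: (bc_uniq (S i)).
- move=> i j b i' j' b' v ji ji' vi vi'; have [e|ii] := eqVneq i i'.
    subst i'; have eb : b = b'.
      apply/eqP/negPn/negP => bb; have := bc_other (S i) ji vi.
      have -> : ~~ b = b' by case: b b' bb {vi vi'} => [] [].
      by rewrite inE (bc_own (S i) ji' vi') orbT.
    by subst b'; split=> //; apply: (bc_int (S i) ji ji' vi vi').
  case: (xy _ _ _ ii (Vi _ _ _ _ ji vi) (Vi _ _ _ _ ji' vi')) => e.
  - by have := cutni i j b i 0 ji isT; rewrite (bc_x (S i)) -e vi.
  - by have := cutni i j b i (n i) ji (leqnn _); rewrite (bc_y (S i)) -e vi.
- move=> i j i' j' ji ji' e; have [ii|ii] := eqVneq i i'.
    by subst i'; apply: Or31; split=> //; apply: (bc_inj (S i) ji ji' e).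
  have vi' := Vc i' j' ji'; rewrite -e in vi'.
  case: (xy _ _ _ ii (Vc i j ji) vi') => ev.
  - apply: Or32; split; [apply: (bc_inj (S i)) | apply: (bc_inj (S i'))] => //.
      by rewrite (bc_x (S i)).
    by rewrite (bc_x (S i')) -e.
  - apply: Or33; split; [apply: (bc_inj (S i)) | apply: (bc_inj (S i'))] => //.
      by rewrite (bc_y (S i)).
    by rewrite (bc_y (S i')) -e.
- move=> i j ji; apply/eqP => e; have ed := bc_thin (S i) ji e.
  case: (ex i) => _ _ dis _.
  by have := disjointFr dis (ed true); rewrite (ed false).
Qed.

(** * Cycles through the two poles *)

(** [Z] follows [P] from the vertex after [x] to [y] and returns along [Q], so that [x] comes
    last. *)
Lemma cycle_of_paths (G : sgraph) (x y : G) P Q (Z := P ++ rev (belast x Q)) : x != y ->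
  is_path x y P -> is_path x y Q -> (forall v, v \in P -> v \in Q -> v = y) ->
  [/\ uniq Z, cycle (@adj G) Z, size Z = size P + size Q, last y Z = x &
      Z =i [predU x :: P & x :: Q]].
Proof.
move=> xy /and3P[pP /eqP py pu] /and3P[qP /eqP qy qu] PQ.
have BE : x :: Q = rcons (belast x Q) y by rewrite lastI qy.
have Bn v : v \in belast x Q -> v \in x :: Q /\ v != y.
  move=> vB; rewrite BE mem_rcons inE vB orbT; split=> //.
  by move: qu; rewrite BE rcons_uniq => /andP[yB _]; apply: contraNneq yB => <-.
have yP : y \in P by have := mem_last x P; rewrite py inE eq_sym (negPf xy).
have xB : x \in belast x Q by case: (Q) qy => [/eqP|z q] /=; rewrite ?(negPf xy) ?mem_head.
have lastZ : last y Z = x.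
  rewrite /Z last_cat; case: (Q) qy => [/eqP|z q _] /=; rewrite ?(negPf xy) //.
  by rewrite rev_cons last_rcons.
split=> //.
- rewrite /Z cat_uniq rev_uniq; move: pu; rewrite cons_uniq => /andP[xP ->].
  move: qu; rewrite BE rcons_uniq => /andP[_ ->]; rewrite andbT.
  apply/hasPn => v; rewrite mem_rev => /Bn[]; rewrite inE => /orP[/eqP-> //|vQ vy].
  by apply: contra vy => /PQ ->.
- have cE : cycle (@adj G) Z = path (@adj G) (last y Z) Z by case: (Z) => // z s; rewrite /= rcons_path andbC; case: s.
  rewrite cE lastZ cat_path pP py -[in path _ y]qy rev_path.
  by rewrite (eq_path (e' := @adj G)) // => a b; rewrite adj_sym.
- by rewrite size_cat size_rev size_belast.
- move=> v; rewrite mem_cat mem_rev [in RHS]inE [_ x Q]/= BE mem_rcons !inE.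
  have [->|vx] := eqVneq v x; first by rewrite xB orbT.
  by have [->|] := eqVneq v y; first by rewrite yP.
Qed.

Lemma index_last_cat (T : eqType) (x u : T) s1 s2 : uniq (s1 ++ s2) -> s1 != [::] ->
  last x s1 = u -> (index u (s1 ++ s2)).+1 = size s1.
Proof.
case/lastP: s1 => // s z; rewrite last_rcons size_rcons => us _ <-.
move: us; rewrite cat_rcons cat_uniq index_cat => /and3P[_ /hasPn/(_ z (mem_head _ _)) /negPf /= -> _].
by rewrite eqxx addn0.
Qed.

Lemma path_rev (G : sgraph) (x y : G) r : path (@adj G) x (rcons r y) -> path (@adj G) y (rev r).
Proof.
move=> p; have : path (@adj G) (last x (rcons r y)) (rev (belast x (rcons r y))).
  by rewrite rev_path (eq_path (e' := @adj G)) // => a b; rewrite adj_sym.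
by rewrite last_rcons belast_rcons rev_cons rcons_path => /andP[].
Qed.

Section Theta.
Variables (H : sgraph) (n : 'I_3 -> nat) (cut : 'I_3 -> nat -> H) (int : 'I_3 -> nat -> bool -> seq H).
Hypothesis S : f2s n cut int.
Implicit Types (phi : nat -> bool).

(** A walk in the [i]-th bipath from [cut i a] to [cut i (a + m)], without its first vertex. The
    side may change at each cut, as chosen by [phi]. *)
Definition seg i phi a m := flatten [seq rcons (int i j (phi j)) (cut i j.+1) | j <- iota a m].

Lemma segS i phi a m : seg i phi a m.+1 = rcons (int i a (phi a)) (cut i a.+1) ++ seg i phi a.+1 m.
Proof. by []. Qed.

Lemma seg_cat i phi a m k : seg i phi a (m + k) = seg i phi a m ++ seg i phi (a + m) k.
Proof. by rewrite /seg iotaD map_cat flatten_cat. Qed.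

Lemma seg_path i phi a m : a + m <= n i -> path (@adj H) (cut i a) (seg i phi a m).
Proof.
elim: m a => // m IH a le; rewrite segS cat_path last_rcons (f2_path S) ?IH //.
  by move: le; rewrite addnS.
by move: le; clear; lia.
Qed.

Lemma seg_last i phi a m : last (cut i a) (seg i phi a m) = cut i (a + m).
Proof. by elim: m a => [|m IH] a; rewrite ?addn0 // segS last_cat last_rcons IH addnS. Qed.

Lemma mem_seg i phi a m v : reflect
  ((exists2 j, a <= j < a + m & v \in int i j (phi j)) \/ (exists2 j, a <= j <= a + m & v = cut i j))
  (v \in cut i a :: seg i phi a m).
Proof.
elim: m a => [|m IH] a.
  rewrite inE; apply: (iffP eqP) => [->|[[j]|[j]]]; first by right; exists a; rewrite // addn0 !leqnn.
    by rewrite addn0; clear; lia.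
  by rewrite addn0 -eqn_leq => /eqP->.
rewrite segS -cat_cons -rcons_cons cat_rcons mem_cat.
apply: (iffP orP) => [[|/IH[[j jm vj]|[j jm vj]]]|[[j jm vj]|[j jm vj]]].
- rewrite inE => /orP[/eqP->|vi]; first by right; exists a; rewrite // leqnn leq_addr.
  by left; exists a; rewrite // leqnn addnS ltnS leq_addr.
- by left; exists j => //; move: jm; clear; lia.
- by right; exists j => //; move: jm; clear; lia.
- have [e|ne] := eqVneq j a; first by left; rewrite inE -{2}e -{2}e vj orbT.
  by right; apply/IH; left; exists j => //; move: jm ne; clear; lia.
- have [e|ne] := eqVneq j a; first by left; rewrite vj e mem_head.
  by right; apply/IH; right; exists j => //; move: jm ne; clear; lia.
Qed.

Lemma cut_inj i j j' : j <= n i -> j' <= n i -> cut i j = cut i j' -> j = j'.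
Proof. by move=> ji ji' /(f2_inj S ji ji') [] [] // -> ->. Qed.

Lemma cut_xy i : cut i 0 != cut i (n i).
Proof. by apply/eqP => /cut_inj; have := f2_n S i; move=> h /(_ isT (leqnn _)); move: h; clear; lia. Qed.

Lemma seg_uniq i phi a m : a + m <= n i -> uniq (cut i a :: seg i phi a m).
Proof.
elim: m a => // m IH a le; rewrite segS -cat_cons -rcons_cons cat_rcons cat_uniq.
have an : a < n i by move: le; clear; lia.
apply/and3P; split; [by rewrite cons_uniq (f2_cut S) ?(f2_uniq S) ?(ltnW an)| |by rewrite IH ?addSnnS].
apply/hasPn => v /mem_seg vs; rewrite inE negb_or.
case: vs => [[j jm vj]|[j jm ->]].
  have jn : j < n i by move: jm le; clear; lia.
  rewrite (contraTneq _ vj) => [|->] /=; last by rewrite (f2_cut S) // ltnW.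
  apply/negP => va; have [_ e _] := f2_int S an jn va vj.
  by move: e jm; clear; lia.
have jn : j <= n i by move: jm le; clear; lia.
rewrite (f2_cut S) // andbT; apply/eqP => /(cut_inj jn (ltnW an)).
by move: jm; clear; lia.
Qed.

Lemma seg_size i phi a m L : a + m <= n i -> 0 < m ->
  (forall j b, j < n i -> L <= size (int i j b)) -> L < size (seg i phi a m).
Proof.
case: m => // m le _ Li; rewrite segS size_cat size_rcons.
have an : a < n i by move: le; clear; lia.
by have := Li a (phi a) an; clear; lia.
Qed.

Definition pth i phi := seg i phi 0 (n i).

Lemma pth_is_path i phi : is_path (cut i 0) (cut i (n i)) (pth i phi).
Proof. by rewrite /is_path seg_path // seg_last eqxx seg_uniq. Qed.

Definition bivertices i := [set v in cut i 0 :: pth i xpredT] :|: [set v in cut i 0 :: pth i xpred0].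

Lemma bivertexP i v : reflect
  ((exists j b, j < n i /\ v \in int i j b) \/ (exists2 j, j <= n i & v = cut i j)) (v \in bivertices i).
Proof.
rewrite !inE -!in_cons; apply: (iffP orP).
  by case=> /mem_seg[[j jn vj]|[j jn ->]]; [left; exists j, true|right; exists j|left; exists j, false|right; exists j].
case=> [[j [b [jn vj]]]|[j jn ->]]; last by left; apply/mem_seg; right; exists j.
by case: b vj => vj; [left|right]; apply/mem_seg; left; exists j.
Qed.

Lemma pth_bivertices i phi v : v \in cut i 0 :: pth i phi -> v \in bivertices i.
Proof. by case/mem_seg=> [[j jn vj]|[j jn ->]]; apply/bivertexP; [left; exists j, (phi j) | right; exists j]. Qed.

Lemma bivertices_meet i i' v : i != i' -> v \in bivertices i -> v \in bivertices i' -> v = cut i 0 \/ v = cut i (n i).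
Proof.
move=> ii /bivertexP[[j [b [jn vj]]]|[j jn ->]] /bivertexP[[j' [b' [jn' vj']]]|[j' jn' e]].
- by have [e _ _] := f2_int S jn jn' vj vj'; rewrite e eqxx in ii.
- by have := f2_cut S b jn jn'; rewrite -e vj.
- by have := f2_cut S b' jn' jn; rewrite vj'.
- case: (f2_inj S jn jn' e) => [[e' _]|[-> _]|[-> _]]; [|by left|by right].
  by rewrite e' eqxx in ii.
Qed.

(** Inclusion-exclusion: the two sides share at most the [n i + 1] cut vertices. *)
Lemma card_bivertices i : size (pth i xpredT) + size (pth i xpred0) < #|bivertices i| + n i.
Proof.
have sz phi : #|[set v in cut i 0 :: pth i phi]| = (size (pth i phi)).+1.
  by rewrite cardsE (card_uniqP _) // seg_uniq.
rewrite /bivertices cardsU !sz; set I := _ :&: _.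
have : #|I| <= (n i).+1.
  apply: leq_trans (_ : #|[set cut i (val j) | j : 'I_(n i).+1]| <= _); last first.
    by apply: leq_trans (leq_imset_card _ _) _; rewrite card_ord.
  apply/subset_leq_card/subsetP => v; rewrite !inE -!in_cons => /andP[/mem_seg vt /mem_seg vf].
  have im j : j <= n i -> cut i j \in [set cut i (val j) | j : 'I_(n i).+1].
    by move=> jn; apply/imsetP; exists (Ordinal (jn : j < (n i).+1)).
  case: vt => [[j jn vj]|[j jn ->]]; last exact: im.
  case: vf => [[j' jn' vj']|[j' jn' ->]]; last exact: im.
  by have [] := f2_int S jn jn' vj vj'.
have : #|I| <= (size (pth i xpredT)).+1 by rewrite -sz subset_leq_card // subsetIl.
clear; lia.
Qed.

Lemma card_bivertices_le i b : (forall b', size (pth i (fun=> b')) <= size (pth i (fun=> b))) ->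
  #|bivertices i| <= (size (pth i (fun=> b))).*2 + 2.
Proof.
move=> mx; rewrite /bivertices cardsU.
have sz phi : #|[set v in cut i 0 :: pth i phi]| = (size (pth i phi)).+1.
  by rewrite cardsE (card_uniqP _) // seg_uniq.
by rewrite !sz; have := mx true; have := mx false; clear; lia.
Qed.

Lemma card_biverticesU i i' : i != i' -> #|bivertices i| + #|bivertices i'| <= #|bivertices i :|: bivertices i'| + 2.
Proof.
move=> ii; rewrite -cardsUI leq_add2l.
apply: leq_trans (_ : #|[set cut i 0; cut i (n i)]| <= 2); last by rewrite cards2; case: (_ != _).
apply/subset_leq_card/subsetP => v /setIP[vi vi']; rewrite !inE.
by case: (bivertices_meet ii vi vi') => ->; rewrite eqxx ?orbT.
Qed.

Definition cyc i1 i2 phi1 phi2 := pth i1 phi1 ++ rev (belast (cut i1 0) (pth i2 phi2)).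

Lemma cycP i1 i2 phi1 phi2 (Z := cyc i1 i2 phi1 phi2) : i1 != i2 ->
  [/\ uniq Z, cycle (@adj H) Z, size Z = size (pth i1 phi1) + size (pth i2 phi2),
      last (cut i1 (n i1)) Z = cut i1 0 &
      Z =i [predU cut i1 0 :: pth i1 phi1 & cut i1 0 :: pth i2 phi2]].
Proof.
move=> ii; apply: (@cycle_of_paths _ (cut i1 0) (cut i1 (n i1)));
  rewrite ?cut_xy ?pth_is_path //.
  by have := pth_is_path i2 phi2; rewrite (f2_x S i2 i1) (f2_y S i2 i1).
move=> v v1 v2; case: (bivertices_meet ii (_ : v \in _) (_ : v \in _)) => //.
- by apply: (@pth_bivertices i1 phi1); rewrite in_cons v1 orbT.
- by apply: (@pth_bivertices i2 phi2); rewrite in_cons v2 orbT.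
- move=> e; case/and3P: (pth_is_path i1 phi1) => _ _; rewrite cons_uniq => /andP[].
  by rewrite -e v1.
Qed.

(* One of the two arcs between consecutive shared vertices may be removed; [rm]
   selects the removed arcs. *)
Lemma tight_rm i1 i2 (rm : 'I_3 -> nat -> bool -> bool) (F : {set H}) : i1 != i2 ->
  (forall i j, ~~ (rm i j true && rm i j false)) ->
  (forall v, v \in F <-> exists2 i, i \in [:: i1; i2] &
     (exists j b, [/\ j < n i, ~~ rm i j b & v \in int i j b]) \/
     (exists2 j, j <= n i & v = cut i j)) ->
  tight F.
Proof.
move=> ii rm2 FP; pose ok (phi : 'I_3 -> nat -> bool) := forall i j, ~~ rm i j (phi i j).
apply: (@tight_cycles _ _ (cut i1 0) (cut i1 (n i1))
  (fun Z => exists2 phi, ok phi & Z = cyc i1 i2 (phi i1) (phi i2))); first exact: cut_xy.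
  move=> Z [phi okphi ->]; have [Zu Zc _ lastZ memZ] := cycP (phi i1) (phi i2) ii.
  have inF i v : i \in [:: i1; i2] -> v \in cut i 0 :: pth i (phi i) -> v \in F.
    move=> i12 /mem_seg[[j jn vj]|[j jn ->]]; apply/FP; exists i => //; last by right; exists j.
    by left; exists j, (phi i j); split.
  split=> //; last 2 first.
  - by rewrite memZ inE mem_head.
  - rewrite memZ inE; apply/orP; left; apply/mem_seg; right; exists (n i1) => //.
    by rewrite /= add0n leqnn.
  move=> v; rewrite memZ inE => /orP[]; first by apply: inF; rewrite mem_head.
  by rewrite (f2_x S i1 i2); apply: inF; rewrite !inE eqxx orbT.
(* [phi0] takes the side [true] unless it is removed. Changing it at a single place makes the cycle
   pass through any given arc that remains. *)
pose phi0 i j := ~~ rm i j true.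
have ok0 : ok phi0 by move=> i j; have := rm2 i j; rewrite /phi0; case E: (rm i j true) => /=; rewrite ?E.
have inZ (phi : 'I_3 -> nat -> bool) i v : i \in [:: i1; i2] -> v \in cut i 0 :: pth i (phi i) ->
    v \in cyc i1 i2 (phi i1) (phi i2).
  have [_ _ _ _ ->] := cycP (phi i1) (phi i2) ii; rewrite !inE -!in_cons.
  by case/orP=> /eqP->; rewrite ?(f2_x S i2 i1) => ->; rewrite ?orbT.
move=> v /FP[i i12 [[j [b [jn rmb vj]]]|[j jn ->]]].
  pose phi k l := if (k == i) && (l == j) then b else phi0 k l.
  exists (cyc i1 i2 (phi i1) (phi i2)).
    exists phi => // k l; rewrite /phi; case: ifP => [/andP[/eqP-> /eqP->]//|_].
    exact: ok0.
  by apply: (inZ _ i) => //; apply/mem_seg; left; exists j; rewrite // /phi !eqxx.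
exists (cyc i1 i2 (phi0 i1) (phi0 i2)); first by exists phi0.
by apply: (inZ _ i) => //; apply/mem_seg; right; exists j.
Qed.

(** The list [cyc] starts just after the pole [cut i1 0], whence the shift by one; the pole itself
    is last. *)
Lemma index_cyc i1 i2 phi1 phi2 k : i1 != i2 -> 0 < k <= n i1 ->
  (index (cut i1 k) (cyc i1 i2 phi1 phi2)).+1 = size (seg i1 phi1 0 k).
Proof.
move=> ii /andP[k0 kn]; have [Zu _ _ _ _] := cycP phi1 phi2 ii.
have e : cyc i1 i2 phi1 phi2 = seg i1 phi1 0 k ++ (seg i1 phi1 k (n i1 - k) ++
    rev (belast (cut i1 0) (pth i2 phi2))).
  by rewrite catA -seg_cat subnKC.
rewrite e in Zu *; apply: (index_last_cat (x := cut i1 0)) => //; last by rewrite seg_last.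
by case: k k0 {kn e Zu} => // k _; rewrite segS -size_eq0 size_cat size_rcons.
Qed.

Lemma index_cyc0 i1 i2 phi1 phi2 : i1 != i2 ->
  (index (cut i1 0) (cyc i1 i2 phi1 phi2)).+1 = size (cyc i1 i2 phi1 phi2).
Proof.
move=> ii; have [Zu _ _ lastZ _] := cycP phi1 phi2 ii.
rewrite -{1}[cyc _ _ _ _]cats0; apply: index_last_cat (lastZ); first by rewrite cats0.
apply/eqP => e; move: lastZ; rewrite e => /esym/eqP; rewrite (negPf (cut_xy i1)).
by [].
Qed.

(* The cycle avoids the arc and takes a short side of the bipath [i2]; its
   terminals are the two poles, with rays inside the bipath [i3], and an end of
   the arc, with its ray inside the arc. *)
Lemma long_arc_uncapturable i1 i2 i3 j0 b0 b2 b3 c (s : seq {set H}) :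
  i1 != i2 -> i1 != i3 -> i2 != i3 -> j0 < n i1 -> 10 <= c ->
  (forall i j b, j < n i -> c <= size (int i j b)) ->
  size (pth i1 (fun=> ~~ b0)) + size (pth i2 (fun=> b2)) <= size (int i1 j0 b0) + c ->
  size (pth i1 (fun=> ~~ b0)) + size (pth i2 (fun=> b2)) < size (pth i3 (fun=> b3)) + c ->
  (forall A : {set H}, A \in s -> #|A| <= 3) -> ~ captures s.
Proof.
move=> i12 i13 i23 j0n c10 ci ce c3.
set Z := cyc i1 i2 (fun=> ~~ b0) (fun=> b2).
have [Zu Zc szZ _ memZ] := cycP (fun=> ~~ b0) (fun=> b2) i12; rewrite -/Z in Zu Zc szZ memZ.
rewrite -szZ in ce c3.
have ZV v : v \in Z -> v \in bivertices i1 \/ v \in bivertices i2.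
  rewrite memZ => /orP[/pth_bivertices|]; first by left.
  by rewrite (f2_x S i1 i2) => /pth_bivertices; right.
have n1 := f2_n S i1; have n2 := f2_n S i2.
have cseg i phi a m : a + m <= n i -> 0 < m -> c < size (seg i phi a m).
  by move=> le m0; apply: seg_size => // j b; apply: ci.
have cP : c < size (pth i1 (fun=> ~~ b0)) by apply: cseg => //; move: n1; clear; lia.
have cQ : c < size (pth i2 (fun=> b2)) by apply: cseg => //; move: n2; clear; lia.
pose m := size Z - c.
(* [cut i1 k] is an end of the arc that is not a pole. For [j0 = 0] it is the far end, so the arc is
   read backwards. *)
pose k := if j0 is 0 then 1 else j0.
pose e := if j0 is 0 then rev (int i1 j0 b0) else int i1 j0 b0.
have k1 : 0 < k < n i1.
  by rewrite /k; case: (j0) j0n => [_|j -> //]; rewrite n1.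
have szk : (c < size (seg i1 (fun=> ~~ b0) 0 k)) && (c < size (seg i1 (fun=> ~~ b0) k (n i1 - k))).
  by case/andP: k1 => k0 kn; rewrite !cseg //; move: k0 kn; clear; lia.
have szP : size (pth i1 (fun=> ~~ b0)) = size (seg i1 (fun=> ~~ b0) 0 k) +
    size (seg i1 (fun=> ~~ b0) k (n i1 - k)).
  by rewrite -size_cat -seg_cat subnKC //; case/andP: k1 => _ /ltnW.
have ePath : path (@adj H) (cut i1 k) e.
  have := f2_path S b0 j0n; rewrite /e /k; case: (j0) => [|j]; first exact: path_rev.
  by rewrite rcons_path => /andP[].
have szE : size e = size (int i1 j0 b0) by rewrite /e; case: (j0); rewrite ?size_rev.
have memE v : v \in e -> v \in int i1 j0 b0 by rewrite /e; case: (j0); rewrite ?mem_rev.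
have eZ v : v \in e -> v \notin Z.
  move/memE=> ve; rewrite memZ; apply/negP => /orP[/mem_seg[[j jn vj]|[j jn vj]]|].
  - by have [_ _] := f2_int S j0n jn ve vj; case: (b0).
  - by have := f2_cut S b0 j0n jn; rewrite -vj ve.
  rewrite (f2_x S i1 i2) => /mem_seg[[j jn vj]|[j jn vj]].
  - by have [h _ _] := f2_int S j0n jn ve vj; rewrite h eqxx in i12.
  - by have := f2_cut S b0 j0n jn; rewrite -vj ve.
(* Both poles use the interior [R] of one side of the bipath [i3], read in opposite directions.
   Their rays may overlap, as each ray is only counted together with the cycle. *)
have [R [Rx Ry RZ [Ru szR]]] : exists R, [/\ path (@adj H) (cut i1 0) R,
    path (@adj H) (cut i1 (n i1)) (rev R), forall v, v \in R -> v \notin Z &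
    uniq R /\ (size R).+1 = size (pth i3 (fun=> b3))].
  have := pth_is_path i3 (fun=> b3); have := @pth_bivertices i3 (fun=> b3).
  rewrite (f2_x S i3 i1) (f2_y S i3 i1); case/lastP: (pth i3 _) => [|R z] RV.
    by case/and3P=> _ /=; rewrite (negPf (cut_xy i1)).
  case/and3P=> Rp; rewrite last_rcons => /eqP ez; rewrite ez in Rp *.
  rewrite -rcons_cons rcons_uniq => /andP[yR]; rewrite cons_uniq => /andP[xR Ru].
  exists R; split; rewrite ?size_rcons //.
  - by move: Rp; rewrite rcons_path => /andP[].
  - exact: path_rev Rp.
  - move=> v vR; have vx : v != cut i1 0 by apply: contraNneq xR => <-.
    have vy : v != cut i1 (n i1) by apply: contraNneq yR => <-; rewrite inE vR orbT.
    have v3 : v \in bivertices i3 by apply: RV; rewrite in_cons mem_rcons in_cons vR !orbT.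
    apply/negP => /ZV[] vV.
    + by case: (bivertices_meet i13 vV v3) => e'; move: vx vy; rewrite e' eqxx.
    + by case: (bivertices_meet i23 vV v3) => e'; move: vx vy; rewrite (f2_x S i1 i2) (f2_y S i1 i2) e' eqxx.
pose tm (a : 'I_3) := nth (cut i1 0) [:: cut i1 0; cut i1 (n i1); cut i1 k] a.
pose ray (a : 'I_3) := take m (nth [::] [:: R; rev R; e] a).
have all3 (Q : 'I_3 -> Prop) : Q ord0 -> Q (inord 1) -> Q ord_max -> forall a, Q a.
  move=> q0 q1 q2 [[|[|[|a]]] lt] //.
  - by rewrite (_ : Ordinal lt = ord0) //; apply/val_inj.
  - by rewrite (_ : Ordinal lt = inord 1) //; apply/val_inj; rewrite /= inordK.
  - by rewrite (_ : Ordinal lt = ord_max) //; apply/val_inj.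
have tm1 : tm (inord 1) = cut i1 (n i1) by rewrite /tm inordK.
have ray1 : ray (inord 1) = take m (rev R) by rewrite /ray inordK.
have path_take x r : path (@adj H) x r -> path (@adj H) x (take m r).
  by rewrite -{1}(cat_take_drop m r) cat_path => /andP[].
apply: (@cycle_rays_uncapturable _ Z c tm ray s) => //.
- have idx0 := index_cyc0 (fun=> ~~ b0) (fun=> b2) i12; rewrite -/Z in idx0.
  have idx j : 0 < j <= n i1 -> (index (cut i1 j) Z).+1 = size (seg i1 (fun=> ~~ b0) 0 j).
    exact: index_cyc.
  have idxy := idx (n i1); rewrite leqnn andbT -/(pth i1 _) in idxy.
  have idxw := idx k; case/andP: k1 => k0 kn; rewrite k0 (ltnW kn) in idxw.
  have inZ j : j <= n i1 -> cut i1 j \in Z.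
    by move=> jn; rewrite memZ inE; apply/orP; left; apply/mem_seg; right; exists j.
  move: szk szP cP cQ szZ idx0 (idxy (ltnW n1)) (idxw isT) => {idxy idxw idx} szk szP cP cQ szZ idx0 idxy idxw.
  have sxy : separated Z c (cut i1 0) (cut i1 (n i1)).
    by rewrite /separated !inZ //; move: szk szP cP cQ szZ idx0 idxy idxw; clear; rewrite /=; lia.
  have sxw : separated Z c (cut i1 0) (cut i1 k).
    by rewrite /separated !inZ ?(ltnW kn) //; move: szk szP cP cQ szZ idx0 idxy idxw; clear; rewrite /=; lia.
  have syw : separated Z c (cut i1 (n i1)) (cut i1 k).
    by rewrite /separated !inZ ?(ltnW kn) //; move: szk szP cP cQ szZ idx0 idxy idxw; clear; rewrite /=; lia.
  apply: (all3); apply: (all3); rewrite ?eqxx ?tm1 //=; by rewrite separatedC.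
- by apply: (all3); rewrite ?tm1 ?ray1; apply: path_take.
- by apply: (all3); rewrite ?ray1; apply: take_uniq; rewrite ?rev_uniq // /e; case: (j0) j0n => [|j] lt;
    rewrite ?rev_uniq (f2_uniq S).
- have szt r : m <= size r -> size (take m r) + c = size Z.
    move=> le; rewrite size_takel // /m; move: cP szZ; clear; lia.
  apply: (all3); rewrite ?ray1; apply: szt; rewrite ?size_rev /= ?szE /m; move: c3 ce szR; clear; lia.
- by apply: (all3); rewrite ?ray1 => v /mem_take; rewrite ?mem_rev; auto.
Qed.
End Theta.

(** * Choice between the two obstructions *)

Lemma other_two (i3 : 'I_3) : exists i1 i2, [/\ i1 != i2, i1 != i3, i2 != i3 &
  forall i, i != i3 -> i = i1 \/ i = i2].
Proof.
have : [exists i1, exists i2, [&& i1 != i2, i1 != i3, i2 != i3 &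
    [forall i, (i != i3) ==> ((i == i1) || (i == i2))]]].
  have card2 : #|[set~ i3]| = 2 by rewrite cardsC1 card_ord.
  have /cards2P[i1 [i2 [ii e]]] : #|[set~ i3]| == 2 by rewrite card2.
  have ne i : (i != i3) = (i == i1) || (i == i2) by rewrite -in_setC1 e !inE.
  apply/existsP; exists i1; apply/existsP; exists i2; rewrite ii !ne !eqxx ?orbT /=.
  by apply/forallP => i; rewrite ne implybb.
case/existsP=> i1 /existsP[i2 /and4P[h1 h2 h3 /forallP h4]]; exists i1, i2; split=> // i i3n.
by have := h4 i; rewrite i3n => /orP[]/eqP; auto.
Qed.

Lemma uncapturable n : exists L, forall (H : sgraph) (s : seq {set H}), long n L H ->
  (forall A : {set H}, A \in s -> #|A| <= 3) -> ~ captures s.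
Proof.
(* The index [(i, j, Some b)] stands for an arc and [(i, j, None)] for a cut vertex. The successor
   in [N] makes room for [j = n i]. *)
pose N := (\max_i n i).+1; pose I := ('I_3 * 'I_N * option bool)%type.
(* [T] is the slack in the bound for small cells; [N.*2] absorbs the vertices shared by the two
   sides of the bipaths. *)
pose T := 2 ^ #|{: I}| + 10; pose c := T + N.*2 + 10.
have nN i : n i < N by rewrite ltnS; apply: leq_bigmax.
exists c => H s [cut [int [S ci]]] s3.
pose W i := bivertices n cut int i.
have VS i v : reflect ((exists j b, j < n i /\ v \in int i j b) \/ (exists2 j, j <= n i & v = cut i j))
    (v \in W i) by apply: bivertexP.
have [i3 _ i3max] : {i3 | true & forall i, #|W i| <= #|W i3|}.
  by case: (@arg_maxnP _ ord0 predT (fun i => #|W i|)) => // i _ h; exists i => // j; apply: h.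
have [i1 [i2 [i12 i13 i23 only]]] := other_two i3.
(* Up to constants, the arc has at least half of [#|W k1| + #|W k2|] vertices, and the cycle at most
   [#|W k1| + #|W k2| / 2] minus the size of the arc. So the cycle is no longer than the arc, nor
   than [#|W k1| / 2], which is at most the longer side of the largest bipath [i3]. *)
have long_arc k1 k2 j0 b0 : k1 != k2 -> k1 != i3 -> k2 != i3 -> j0 < n k1 ->
    #|W k1 :|: W k2| < (size (int k1 j0 b0)).*2 + T -> ~ captures s.
  move=> k12 k13 k23 jn big.
  pose p k b := size (pth n cut int k (fun=> b)).
  have p12 k : p k true + p k false < #|W k| + n k := card_bivertices S k.
  have pn : p k1 (~~ b0) + p k1 b0 < #|W k1| + n k1.
    by have := p12 k1; case: (b0) => //=; rewrite addnC.
  have ge : size (int k1 j0 b0) <= (p k1 b0).+1.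
    apply: (@uniq_leq_size _ _ (cut k1 0 :: pth n cut int k1 (fun=> b0))); first exact: (f2_uniq S).
    by move=> v vi; apply/mem_seg; left; exists j0.
  have [b2 le2] : exists b2, (p k2 b2).*2 < #|W k2| + n k2.
    by have := p12 k2; case: (leqP (p k2 true) (p k2 false)) => h lt; [exists true | exists false];
      move: h lt; clear; lia.
  have [b3 le3] : exists b3, forall b, p i3 b <= p i3 b3.
    by case: (leqP (p i3 true) (p i3 false)) => h; [exists false | exists true]; case=> //; apply: ltnW.
  have v3 : #|W i3| <= (p i3 b3).*2 + 2 := card_bivertices_le S le3.
  have v12 : #|W k1| + #|W k2| <= #|W k1 :|: W k2| + 2 := card_biverticesU S k12.
  apply: (long_arc_uncapturable S k12 k13 k23 (b0 := b0) (b2 := b2) (b3 := b3) jn (c := c)) => //.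
  - by rewrite /c; clear; lia.
  - rewrite -/(p _ _) -/(p _ _).
    move: pn ge le2 v12 big (nN k1) (nN k2); rewrite /c; clear; lia.
  - rewrite -/(p _ _) -/(p _ _) -/(p _ _).
    move: pn ge le2 v12 big (nN k1) (nN k2) v3 (i3max k1) (i3max k2); rewrite /c; clear; lia.
pose cell (e : I) := if e.1.1 == i3 then set0 else
  if e.2 is Some b then if e.1.2 < n e.1.1 then [set v in int e.1.1 e.1.2 b] else set0
  else if e.1.2 <= n e.1.1 then [set cut e.1.1 e.1.2] else set0.
pose arc : {pred I} := fun e => [&& e.1.1 != i3, e.1.2 < n e.1.1 & e.2].
have arcP e : arc e -> exists b, [/\ e.1.1 != i3, e.1.2 < n e.1.1, e.2 = Some b &
    cell e = [set v in int e.1.1 e.1.2 b]].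
  case: e => -[i j] [b|] /and3P[//= h1 h2 _]; exists b; split=> //.
  by rewrite /cell /= (negPf h1) h2.
pose F := W i1 :|: W i2.
have i12P i : i \in [:: i1; i2] -> i != i3 by rewrite !inE => /orP[]/eqP->.
have FP v : v \in F <-> exists2 i, i \in [:: i1; i2] &
     (exists j b, j < n i /\ v \in int i j b) \/ (exists2 j, j <= n i & v = cut i j).
  rewrite in_setU; split=> [/orP[] h|[i]].
  - by exists i1; rewrite ?inE ?eqxx //; apply/VS.
  - by exists i2; rewrite ?inE ?eqxx ?orbT //; apply/VS.
  - by rewrite in_cons mem_seq1 => /orP[]/eqP-> h; apply/orP; [left|right]; apply/VS.
have tF : tight F.
  apply: (tight_rm S (rm := fun _ _ _ => false) i12) => // v; split=> [/FP|] [i ii [[j [b h]]|h]].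
  - by exists i => //; left; exists j, b; case: h.
  - by exists i => //; right.
  - by apply/FP; exists i => //; left; exists j, b; case: h.
  - by apply/FP; exists i => //; right.
have tFi e : arc e -> tight (F :\: cell e).
  move=> /arcP[b0 [h1 h2 _ ->]]; move: e.1.1 (val e.1.2) h1 h2 => i0 j0 h1 h2.
  apply: (tight_rm S (rm := fun i j b => [&& i == i0, j == j0 & b == b0]) i12).
    by move=> i j; case: eqP => //=; case: eqP => //=; case: (b0).
  move=> v; rewrite inE [in X in ~~ X]inE; split.
    case/andP=> nv /FP[i ii [[j [b [jn vj]]]|h]]; exists i => //; last by right.
    left; exists j, b; split=> //; apply/negP => /and3P[/eqP e1 /eqP e2 /eqP e3].
    by move: nv; rewrite -e1 -e2 -e3 vj.
  case=> i ii [[j [b [jn rmb vj]]]|[j jn ->]].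
    apply/andP; split; last by apply/FP; exists i => //; left; exists j, b.
    apply: contra rmb => vi; have [-> -> ->] := f2_int S jn h2 vj vi.
    by rewrite !eqxx.
  rewrite (f2_cut S) //=; apply/FP; exists i => //; by right; exists j.
have defF : F = \bigcup_e cell e.
  apply/setP => v; apply/idP/bigcupP => [/FP[i /i12P i3n [[j [b [jn vj]]]|[j jn ->]]]|[e _]].
  - have jN : j < N by apply: ltn_trans jn (nN i).
    by exists (i, Ordinal jN, Some b); rewrite // /cell /= (negPf i3n) jn inE.
  - have jN : j < N by apply: leq_ltn_trans jn (nN i).
    by exists (i, Ordinal jN, None); rewrite // /cell /= (negPf i3n) jn inE.
  have in12 i : i != i3 -> i \in [:: i1; i2] by case/only=> ->; rewrite !inE eqxx ?orbT.
  case: e => -[i j] o; rewrite /cell /=; case: eqVneq => [_|i3n]; first by rewrite inE.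
  case: o => [b|]; case: ifP => jn; rewrite inE // => vj; apply/FP; exists i => //; rewrite ?in12 //.
    by left; exists j, b.
  by right; exists j => //; apply/eqP.
(* Either a largest arc is clearly below half of [F], and all cells are small, or it has at least
   about half of [F] and [long_arc] applies. *)
pose M := \max_(e in arc) #|cell e|.
have [le|lt] := leqP (M.*2 + 2 ^ #|{: I}| + 10) #|F|.
  apply: (small_cells_uncapturable (I := I) (arc := arc) (cell := cell) defF _ _ tF tFi _ le s3).
  - case=> -[i j] [b|]; rewrite /arc /cell /=.
      by case: eqP => [|_] /=; rewrite ?cards0 // andbT => /negPf->; rewrite cards0.
    by move=> _; case: eqP => [|_]; rewrite ?cards0 //; case: ifP; rewrite ?cards1 ?cards0.
  - move=> e K /arcP[b [_ jn _ ->]] /set0Pn[v /setIP[vK]]; rewrite inE => vi /subsetPn[u].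
    rewrite inE => ui uK; have := f2_path S b jn; rewrite rcons_path => /andP[p _].
    have [||w wi wb] := ray_bd (K := K) p.
    + by apply/orP; right; apply/allPn; exists u.
    + by apply/hasP; exists v.
    + by apply/set0Pn; exists w; rewrite in_setI wb inE.
  - by move=> e ae; apply: (leq_bigmax_cond (F := fun e => #|cell e|)).
have [e ae eM] : {e | e \in arc & M = #|cell e|}.
  apply: eq_bigmax_cond; apply/card_gt0P.
  exists (i1, Ordinal (isT : 0 < N), Some true); rewrite unfold_in /arc /= i13 andbT.
  exact: ltnW (f2_n S i1).
have [b [h1 h2 _ ce]] := arcP e ae; move: lt.
have -> : M = size (int e.1.1 e.1.2 b) by rewrite eM ce cardsE; apply/card_uniqP/(f2_uniq S).
rewrite -addnA -/T => lt; case: (only _ h1) => e1.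
- apply: (long_arc i1 i2 e.1.2 b) => //; first by rewrite -e1.
  by rewrite -[in size _]e1.
- apply: (long_arc i2 i1 e.1.2 b) => //; first by rewrite eq_sym.
    by rewrite -e1.
  by rewrite -[in size _]e1 setUC.
Qed.

Theorem theorem7p4 (G0 : sgraph) (hG0 : in_F2 G0) :
  4 <= topological_inspection_number G0.
Proof.
have [n G0n] := in_F2_long hG0; have [L noL] := uncapturable n.
(* Arcs never shrink under subdivision, so every further subdivision of [H] is still too long for
   three inspections per turn. *)
have [H GH HL] := lengthen L G0n.
rewrite ltnNge; apply/negP => le3.
have [top _] := leastP (ex_intro (topologically_inspectable G0) (#|G0| + 2)
           (@topologically_inspectable_card G0)).
have [H' HH' inH'] := top H GH.
have [[s sk cap] _] := leastP (ex_intro (searcher_wins H') #|H'| (searcher_wins_card H')).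
apply: (noL H' s (long_subdivision HH' HL) _ cap) => A /sk ->.
exact: leq_trans inH' le3.
Qed.
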